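(* Let $p$ be a prime, and let $d \ge 1$ and $N \ge 1$ be integers. Let $Z_{i,k}$, for $1 \le i \le d$ and $k = (k_1,\ldots,k_d) \in \{0,1,\ldots,N\}^d$, be independent standard $\mathbb{Q}_p$-Gaussian random variables, and define the random polynomials \[ F_i(t_1,\ldots,t_d) := \sum_{k \in \{0,1,\ldots,N\}^d} Z_{i,k} \binom{t_1}{k_1}\binom{t_2}{k_2}\cdots\binom{t_d}{k_d}, \qquad 1 \le i \le d . \] Then the expected number of points $(t_1,\ldots,t_d) \in \mathbb{Z}_p^d$ such that $F_i(t_1,\ldots,t_d) = 0$ for all $1 \le i \le d$ is \[ p^{d \lfloor \log_p N \rfloor}\left(1+p^{-1}+p^{-2}+\cdots+p^{-d}\right)^{-1}. \]
   Context: $\mathbb{Q}_p$ is the field of $p$-adic numbers with absolute value $|\cdot|$ normalized so that $|p| = p^{-1}$, and $\mathbb{Z}_p=\{x \in \mathbb{Q}_p : |x| \le 1\}$ is the ring of $p$-adic integers. A $\mathbb{Q}_p$-valued random variable is standard $\mathbb{Q}_p$-Gaussian if it is distributed according to Haar measure on $\mathbb{Z}_p$ normalized to be a probability measure. For a non-negative integer $m$, $\binom{t}{m} := \frac{t(t-1)\cdots(t-m+1)}{m!}$ (with $\binom{t}{0}=1$). $\log_p$ denotes the real logarithm to base $p$. *)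

(* Defs.v *)
From HB Require Import structures.
From mathcomp Require Import all_boot all_order all_algebra.
From mathcomp Require Import all_classical all_reals all_analysis.
From mathcomp Require Import measurable_realfun.

Set Implicit Arguments.
Unset Strict Implicit.
Unset Printing Implicit Defensive.

Import Order.TTheory GRing.Theory Num.Theory.

Local Open Scope classical_set_scope.
Local Open Scope ring_scope.

(* [x n] is the representative in [0, p^n[ of the residue of [x] modulo [p^n].
   This ring only serves to build [Q_p] as its field of fractions; as a subset
   of [Q_p], [Z_p] is the unit ball [Zp], which is its image (lemma [ZpE]). *)
Record padic_int (p : nat) (p_pr : prime p) := PadicInt {
  padic_res :> nat -> nat;
  padic_res_coh : forall n, (padic_res n.+1 %% p ^ n)%N = padic_res n }.

HB.instance Definition _ p (p_pr : prime p) := gen_eqMixin (padic_int p_pr).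
HB.instance Definition _ p (p_pr : prime p) := gen_choiceMixin (padic_int p_pr).

Section PadicInt.
Context (p : nat) (p_pr : prime p).
Local Notation Z_p := (padic_int p_pr).
Implicit Types x y z : Z_p.

Let p_gt0 : (0 < p)%N. Proof. exact: prime_gt0. Qed.
Let pX_gt0 n : (0 < p ^ n)%N. Proof. by rewrite expn_gt0 p_gt0. Qed.

Lemma padic_int_eq x y : (forall n, x n = y n) -> x = y.
Proof.
case: x y => [x Hx] [y Hy] /= /funext exy; subst y.
by congr PadicInt; exact: Prop_irrelevance.
Qed.

Lemma padic_res_mod x m n : (m <= n)%N -> (x n %% p ^ m)%N = x m.
Proof.
move=> /subnKC <-; elim: (n - m)%N => [|k IH].
  by rewrite addn0 -{1}(padic_res_coh x m) modn_mod padic_res_coh.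
rewrite addnS -IH -(padic_res_coh x (m + k)%N) modn_dvdm //.
by rewrite dvdn_exp2l // leq_addr.
Qed.

Lemma padic_res_small x n : (x n %% p ^ n)%N = x n.
Proof. exact: padic_res_mod. Qed.

(* the sequence of residues of a sequence of natural numbers that is coherent
   modulo the powers of [p] *)
Definition mk_padic_int (u : nat -> nat)
  (hu : forall n, u n.+1 = u n %[mod p ^ n]) : Z_p.
Proof.
exists (fun n => u n %% p ^ n)%N => n.
by rewrite modn_dvdm ?hu // dvdn_exp2l.
Defined.

Lemma padic_cohS x n : x n.+1 = x n %[mod p ^ n].
Proof. by rewrite padic_res_coh padic_res_small. Qed.

Lemma padic_add_coh x y n : (x n.+1 + y n.+1 = x n + y n %[mod p ^ n])%N.
Proof. by rewrite -modnDm !padic_res_coh. Qed.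

Lemma padic_mul_coh x y n : (x n.+1 * y n.+1 = x n * y n %[mod p ^ n])%N.
Proof. by rewrite -modnMm !padic_res_coh. Qed.

Lemma padic_res_le x n : (x n <= p ^ n)%N.
Proof. by rewrite -padic_res_small ltnW // ltn_mod. Qed.

Lemma padic_opp_coh x n : (p ^ n.+1 - x n.+1 = p ^ n - x n %[mod p ^ n])%N.
Proof.
apply/eqP; rewrite -(eqn_modDr (x n.+1)) subnK ?padic_res_le //.
rewrite -modnDmr padic_res_coh subnK ?padic_res_le //.
by rewrite modnn expnS modnMl.
Qed.

Lemma padic_one_coh (n : nat) : (1 = 1 %[mod p ^ n])%N. Proof. by []. Qed.
Lemma padic_zero_coh (n : nat) : (0 = 0 %[mod p ^ n])%N. Proof. by []. Qed.

Definition padic_int_add x y := mk_padic_int (padic_add_coh x y).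
Definition padic_int_mul x y := mk_padic_int (padic_mul_coh x y).
Definition padic_int_opp x := mk_padic_int (padic_opp_coh x).
Definition padic_int_zero := mk_padic_int padic_zero_coh.
Definition padic_int_one := mk_padic_int padic_one_coh.

Fact padic_int_addA : associative padic_int_add.
Proof. by move=> x y z; apply: padic_int_eq => n /=; rewrite modnDml modnDmr addnA. Qed.
Fact padic_int_addC : commutative padic_int_add.
Proof. by move=> x y; apply: padic_int_eq => n /=; rewrite addnC. Qed.
Fact padic_int_add0 : left_id padic_int_zero padic_int_add.
Proof.
by move=> x; apply: padic_int_eq => n /=; rewrite mod0n add0n padic_res_small.
Qed.
Fact padic_int_addN : left_inverse padic_int_zero padic_int_opp padic_int_add.
Proof.
move=> x; apply: padic_int_eq => n /=.
by rewrite modnDml subnK ?padic_res_le // modnn mod0n.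
Qed.

HB.instance Definition _ := GRing.isZmodule.Build Z_p
  padic_int_addA padic_int_addC padic_int_add0 padic_int_addN.

Fact padic_int_mulA : associative padic_int_mul.
Proof. by move=> x y z; apply: padic_int_eq => n /=; rewrite modnMml modnMmr mulnA. Qed.
Fact padic_int_mulC : commutative padic_int_mul.
Proof. by move=> x y; apply: padic_int_eq => n /=; rewrite mulnC. Qed.
Fact padic_int_mul1 : left_id padic_int_one padic_int_mul.
Proof.
by move=> x; apply: padic_int_eq => n /=; rewrite modnMml mul1n padic_res_small.
Qed.
Fact padic_int_mulDl : left_distributive padic_int_mul padic_int_add.
Proof.
by move=> x y z; apply: padic_int_eq => n /=; rewrite modnMml modnDm mulnDl.
Qed.
Fact padic_int_one_neq0 : padic_int_one != padic_int_zero.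
Proof.
apply/eqP => /(congr1 (fun x => padic_res x 1)) /=.
by rewrite mod0n modn_small // expn1 prime_gt1.
Qed.

HB.instance Definition _ := GRing.Zmodule_isComNzRing.Build Z_p
  padic_int_mulA padic_int_mulC padic_int_mul1 padic_int_mulDl
  padic_int_one_neq0.

Definition padic_int_unit : pred Z_p := fun x => `[< exists y, y * x = 1 >].
Definition padic_int_inv x : Z_p := xget x [set y | y * x = 1].

Fact padic_int_mulVx : {in padic_int_unit, left_inverse 1 padic_int_inv *%R}.
Proof.
by move=> x /asboolP [y yx]; rewrite /padic_int_inv; case: xgetP => // /(_ y).
Qed.
Fact padic_int_unitPl x y : y * x = 1 -> padic_int_unit x.
Proof. by move=> yx; apply/asboolP; exists y. Qed.
Fact padic_int_inv_out : {in [predC padic_int_unit], padic_int_inv =1 id}.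
Proof.
move=> x /asboolPn hx; rewrite /padic_int_inv; case: xgetP => // y _ /= yx.
by case: hx; exists y.
Qed.

HB.instance Definition _ := GRing.ComNzRing_hasMulInverse.Build Z_p
  padic_int_mulVx padic_int_unitPl padic_int_inv_out.

(* the largest [n] such that [p^n] divides [x] ([0] if [x = 0]) *)
Definition padic_int_val x : nat := xget 0%N [set n | x n = 0%N /\ x n.+1 <> 0%N].

Lemma padic_res0 x : x 0%N = 0%N.
Proof. by rewrite -padic_res_small expn0 modn1. Qed.

Lemma padic_zeroE n : (0 : Z_p) n = 0%N.
Proof. exact: mod0n. Qed.

Lemma padic_addE x y n : (x + y) n = ((x n + y n) %% p ^ n)%N.
Proof. by []. Qed.

Lemma padic_mulE x y n : (x * y) n = ((x n * y n) %% p ^ n)%N.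
Proof. by []. Qed.

Lemma padic_res_dvd x m n : (m <= n)%N -> (x m == 0%N) = (p ^ m %| x n)%N.
Proof. by move=> mn; rewrite /dvdn padic_res_mod. Qed.

Lemma padic_res_eq0W x m n : (m <= n)%N -> x n = 0%N -> x m = 0%N.
Proof. by move=> mn xn; apply/eqP; rewrite (padic_res_dvd x mn) xn dvdn0. Qed.

Lemma padic_int_valP x : x != 0 ->
  x (padic_int_val x) = 0%N /\ x (padic_int_val x).+1 <> 0%N.
Proof.
move=> x0; rewrite /padic_int_val; case: xgetP => [n _ //|] none; exfalso.
have /ex_minnP [[|n]] : exists n, x n != 0%N.
- apply/not_existsP => h; move/eqP: x0; apply; apply: padic_int_eq => n.
  by rewrite padic_zeroE; have /negP/negPn/eqP := h n.
- by rewrite padic_res0.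
move=> xn min; apply: (none n); split; last exact/eqP.
by apply/eqP/negPn/negP => /min; rewrite ltnn.
Qed.

Lemma padic_int_val_uniq x n : x n = 0%N -> x n.+1 <> 0%N ->
  x != 0 /\ padic_int_val x = n.
Proof.
move=> xn xSn; have x0 : x != 0.
  by apply/eqP => x0; apply: xSn; rewrite x0 padic_zeroE.
split=> //; have [xv xSv] := padic_int_valP x0.
apply/eqP; rewrite eqn_leq; apply/andP; split; rewrite leqNgt; apply/negP => h.
  exact/xSn/(padic_res_eq0W h).
exact/xSv/(padic_res_eq0W h).
Qed.

Lemma padic_int_mul_val x y : x != 0 -> y != 0 -> x * y != 0 /\
  padic_int_val (x * y) = (padic_int_val x + padic_int_val y)%N.
Proof.
move=> /padic_int_valP [] + + /padic_int_valP [].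
set a := padic_int_val x; set b := padic_int_val y => xa xSa yb ySb.
apply: padic_int_val_uniq.
  apply/eqP; rewrite padic_mulE -/(dvdn _ _) expnD dvdn_mul //.
  - by rewrite -padic_res_dvd ?leq_addr // xa.
  - by rewrite -padic_res_dvd ?leq_addl // yb.
apply/eqP; rewrite padic_mulE -/(dvdn _ _).
set n := (a + b).+1.
have an : (a < n)%N by rewrite ltnS leq_addr.
have bn : (b < n)%N by rewrite ltnS leq_addl.
have /dvdnP [x' ex] : (p ^ a %| x n)%N by rewrite -padic_res_dvd ?xa // ltnW.
have /dvdnP [y' ey] : (p ^ b %| y n)%N by rewrite -padic_res_dvd ?yb // ltnW.
have px' : ~~ (p %| x')%N.
  apply: contra_notN xSa => h; apply/eqP.
  by rewrite (padic_res_dvd x an) ex expnS dvdn_mul.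
have py' : ~~ (p %| y')%N.
  apply: contra_notN ySb => h; apply/eqP.
  by rewrite (padic_res_dvd y bn) ey expnS dvdn_mul.
rewrite ex ey mulnACA -expnD /n expnS dvdn_pmul2r //.
by rewrite Euclid_dvdM // negb_or px'.
Qed.

Fact padic_int_integral x y : x * y = 0 -> (x == 0) || (y == 0).
Proof.
case: eqVneq => //= x0; case: eqVneq => //= y0 xy.
by have [] := padic_int_mul_val x0 y0; rewrite xy eqxx.
Qed.

HB.instance Definition _ :=
  GRing.ComUnitRing_isIntegral.Build Z_p padic_int_integral.

Definition padic_int_abs x : rat :=
  if x == 0 then 0 else p%:R ^- padic_int_val x.

Lemma padic_int_abs_eq0 x : (padic_int_abs x == 0) = (x == 0).
Proof.
rewrite /padic_int_abs; have [_|_] := eqVneq x 0; first exact: eqxx.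
by rewrite invr_eq0 expf_eq0 pnatr_eq0 (gtn_eqF p_gt0) andbF.
Qed.

Lemma padic_int_absM x y :
  padic_int_abs (x * y) = padic_int_abs x * padic_int_abs y.
Proof.
rewrite /padic_int_abs; case: (eqVneq x 0) => [->|x0].
  by rewrite !mul0r eqxx.
case: (eqVneq y 0) => [->|y0]; first by rewrite !mulr0 eqxx.
have [/negbTE -> ->] := padic_int_mul_val x0 y0.
by rewrite exprD invfM.
Qed.

Lemma padic_int_abs_ge0 x : 0 <= padic_int_abs x.
Proof. by rewrite /padic_int_abs; case: ifP => // _; rewrite invr_ge0 exprn_ge0. Qed.

Lemma padic_int_abs_le x n : (padic_int_abs x <= p%:R ^- n) = (x n == 0%N).
Proof.
rewrite /padic_int_abs; case: (eqVneq x 0) => [->|x0].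
  by rewrite padic_zeroE eqxx invr_ge0 exprn_ge0.
have [xv xSv] := padic_int_valP x0.
rewrite lef_pV2 ?posrE ?exprn_gt0 ?ltr0n //.
rewrite ler_eXn2l ?ltr1n ?prime_gt1 //.
apply/idP/idP => [h|/eqP xn]; first by rewrite (padic_res_eq0W h xv).
by rewrite leqNgt; apply/negP => h; apply: xSv; exact: padic_res_eq0W h xn.
Qed.

Lemma padic_int_absD x y :
  padic_int_abs (x + y) <= Num.max (padic_int_abs x) (padic_int_abs y).
Proof.
wlog le_xy : x y / padic_int_abs x <= padic_int_abs y.
  move=> h; have /orP [/h //|/h] := le_total (padic_int_abs x) (padic_int_abs y).
  by rewrite addrC maxC.
rewrite (max_r le_xy); have [y0|y0] := eqVneq y 0.
  move: le_xy; rewrite y0 addr0 //.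
have [yv _] := padic_int_valP y0.
have ey : padic_int_abs y = p%:R ^- padic_int_val y.
  by rewrite /padic_int_abs (negbTE y0).
rewrite ey padic_int_abs_le; move: le_xy; rewrite ey padic_int_abs_le => /eqP xv.
by rewrite padic_addE xv yv mod0n.
Qed.

Lemma padic_natE k n : (k%:R : Z_p) n = (k %% p ^ n)%N.
Proof.
elim: k => [|k IH]; first by rewrite mod0n padic_zeroE.
by rewrite -addn1 natrD padic_addE IH modnDm.
Qed.

Lemma padic_unitP x : x 1%N <> 0%N -> exists y, y * x = 1.
Proof.
move=> x1.
have cop n : coprime (x n) (p ^ n).
  case: n => [|n]; first by rewrite expn0 coprimen1.
  rewrite coprime_sym coprime_pexpl // prime_coprime //.
  by apply: contra_notN x1 => h; apply/eqP; rewrite (@padic_res_dvd x 1 n.+1).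
have ex n : exists w, (w * x n = 1 %[mod p ^ n])%N.
  have [xn0|xn_gt0] := posnP (x n).
    by exists 0%N; move: (cop n); rewrite xn0 /coprime gcd0n => /eqP ->; rewrite !modn1.
  case: (egcdnP (p ^ n) xn_gt0) => km kn e _; exists km.
  by move: (cop n); rewrite /coprime => /eqP g1; rewrite e g1 modnMDl.
have [w wx] := choice ex.
have coh n : w n.+1 = w n %[mod p ^ n].
  have wx' : (w n.+1 * x n = 1 %[mod p ^ n])%N.
    have /(congr1 (modn^~ (p ^ n)%N)) := wx n.+1.
    rewrite !modn_dvdm ?dvdn_exp2l // => <-.
    by rewrite -modnMmr -[RHS]modnMmr padic_cohS.
  by rewrite -[w n.+1]muln1 -modnMmr -(wx n) modnMmr mulnCA -modnMmr wx' modnMmr muln1.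
exists (mk_padic_int coh); apply: padic_int_eq => n.
by rewrite padic_mulE modnMml wx.
Qed.

Lemma padic_valK x v : x v = 0%N -> exists y, x = p%:R ^+ v * y.
Proof.
move=> xv.
have coh n : (x (n.+1 + v) %/ p ^ v = x (n + v) %/ p ^ v %[mod p ^ n])%N.
  by rewrite !modn_divl -expnD !padic_res_mod // leq_add2r.
exists (mk_padic_int coh); apply: padic_int_eq => n.
rewrite -natrX padic_mulE padic_natE modnMm mulnC divnK ?padic_res_mod ?leq_addr //.
by rewrite -padic_res_dvd ?leq_addl // xv.
Qed.

End PadicInt.

Definition padic (p : nat) (p_pr : prime p) := {fraction (padic_int p_pr)}.

HB.instance Definition _ p (p_pr : prime p) := GRing.Field.on (padic p_pr).

(* The absolute value takes its values in [{0} U p^Z], hence the codomain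
   [rat]; the resulting metric topology is the usual one. *)
Definition padic_abs p (p_pr : prime p) (x : padic p_pr) : rat :=
  padic_int_abs (frac (repr x)).1 / padic_int_abs (frac (repr x)).2.

Section PadicAbs.
Context (p : nat) (p_pr : prime p).
Local Notation tofrac := (@FracField.tofrac (padic_int p_pr)).
Implicit Types x y z : padic p_pr.

Lemma padic_frac (u : {ratio (padic_int p_pr)}) :
  \pi_({fraction (padic_int p_pr)})%qT u = tofrac (frac u).1 / tofrac (frac u).2.
Proof.
have du : tofrac (frac u).2 != 0 by rewrite tofrac_eq0 denom_ratioP.
apply: (mulIf du); rewrite divfK //; unlock FracField.tofrac.
rewrite -[LHS]FracField.pi_mul; apply/eqmodP => /=.
rewrite FracField.equivfE /FracField.mulf.
by rewrite !numden_Ratio ?mulf_neq0 ?oner_neq0 ?denom_ratioP // !mulr1 mulrC.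
Qed.

Lemma padic_abs_frac (a b : padic_int p_pr) : b != 0 ->
  padic_abs (tofrac a / tofrac b : padic p_pr) = padic_int_abs a / padic_int_abs b.
Proof.
move=> b0; rewrite /padic_abs; set x := tofrac a / tofrac b.
set u := repr x; have d0 : (frac u).2 != 0 by exact: denom_ratioP.
have := padic_frac u; rewrite {1}/u reprK /x => /eqP.
rewrite eqr_div ?tofrac_eq0 // -!tofracM tofrac_eq => /eqP.
move=> /(congr1 (@padic_int_abs p p_pr)); rewrite !padic_int_absM => e.
by apply/eqP; rewrite eqr_div ?padic_int_abs_eq0 // -e.
Qed.

Lemma padic_ind (Q : padic p_pr -> Prop) :
  (forall a b : padic_int p_pr, b != 0 -> Q (tofrac a / tofrac b)) -> forall x, Q x.
Proof. by move=> h x; rewrite -[x]reprK padic_frac; apply: h; exact: denom_ratioP. Qed.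

Lemma padic_abs_tofrac (a : padic_int p_pr) :
  padic_abs (tofrac a : padic p_pr) = padic_int_abs a.
Proof.
have h1 : (1 : padic_int p_pr) != 0 by exact: oner_neq0.
have := padic_abs_frac a h1; rewrite tofrac1 divr1 => ->.
suff -> : padic_int_abs (1 : padic_int p_pr) = 1 by rewrite divr1.
apply: (mulIf (_ : padic_int_abs (1 : padic_int p_pr) != 0)).
  by rewrite padic_int_abs_eq0.
by rewrite -padic_int_absM !mul1r.
Qed.

Lemma padic_abs_eq0 x : (padic_abs x == 0) = (x == 0).
Proof.
elim/padic_ind: x => a b b0; rewrite padic_abs_frac // !mulf_eq0 !invr_eq0.
by rewrite !padic_int_abs_eq0 !tofrac_eq0.
Qed.

Lemma padic_absM x y : padic_abs (x * y) = padic_abs x * padic_abs y.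
Proof.
elim/padic_ind: x => a b b0; elim/padic_ind: y => c e e0.
rewrite mulf_div -!tofracM !padic_abs_frac ?mulf_neq0 // !padic_int_absM.
by rewrite mulf_div.
Qed.

Lemma padic_abs_ge0 x : 0 <= padic_abs x.
Proof. by rewrite divr_ge0 // padic_int_abs_ge0. Qed.

Lemma padic_absD x y : padic_abs (x + y) <= Num.max (padic_abs x) (padic_abs y).
Proof.
elim/padic_ind: x => a b b0; elim/padic_ind: y => c e e0.
rewrite addf_div ?tofrac_eq0 // -!tofracM -tofracD !padic_abs_frac ?mulf_neq0 //.
have b1 : 0 < padic_int_abs b by rewrite lt0r padic_int_abs_eq0 b0 padic_int_abs_ge0.
have e1 : 0 < padic_int_abs e by rewrite lt0r padic_int_abs_eq0 e0 padic_int_abs_ge0.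
have be0 := ltW (mulr_gt0 b1 e1).
rewrite padic_int_absM ler_pdivrMr ?mulr_gt0 // maxr_pMl //.
apply: le_trans (padic_int_absD _ _) _; rewrite !padic_int_absM.
rewrite mulrA divfK ?gt_eqF // [padic_int_abs b * _ in leRHS]mulrC.
by rewrite [padic_int_abs c / _ * _]mulrA divfK ?gt_eqF.
Qed.

Lemma padic_absN x : padic_abs (- x) = padic_abs x.
Proof.
have h : padic_abs (-1 : padic p_pr) = 1.
  apply/eqP; rewrite -(@pexpr_eq1 _ _ 2) ?padic_abs_ge0 //.
  rewrite expr2 -padic_absM mulrNN mulr1 -tofrac1 padic_abs_tofrac.
  apply/eqP; apply: (mulIf (_ : padic_int_abs (1 : padic_int p_pr) != 0)).
    by rewrite padic_int_abs_eq0 oner_neq0.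
  by rewrite -padic_int_absM !mul1r.
by rewrite -mulN1r padic_absM h mul1r.
Qed.

Lemma padic_abs_p : padic_abs (p%:R : padic p_pr) = p%:R^-1.
Proof.
have e n k : (k%:R : padic_int p_pr) n = (k %% p ^ n)%N.
  by elim: k => [|k IH]; rewrite ?mod0n ?padic_zeroE // -addn1 natrD /= IH modnDm.
rewrite -(rmorph_nat (@FracField.tofrac (padic_int p_pr))) padic_abs_tofrac.
have [||p0 v1] := @padic_int_val_uniq p p_pr p%:R 1.
- by rewrite e expn1 modnn.
- rewrite e modn_small; first by move=> p0; move: p_pr; rewrite p0.
  by rewrite -{1}(expn1 p) ltn_exp2l // prime_gt1.
by rewrite /padic_int_abs (negbTE p0) v1 expr1.
Qed.

Definition padic_dist x y := padic_abs (x - y).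

Fact padic_distxx x : padic_dist x x = 0.
Proof. by apply/eqP; rewrite /padic_dist subrr padic_abs_eq0. Qed.
Fact padic_dist_positivity x y : padic_dist x y = 0 -> x = y.
Proof. by move/eqP; rewrite padic_abs_eq0 subr_eq0 => /eqP. Qed.
Fact padic_dist_sym x y : padic_dist x y = padic_dist y x.
Proof. by rewrite /padic_dist -padic_absN opprB. Qed.
Fact padic_dist_triangle y x z :
  padic_dist x z <= padic_dist x y + padic_dist y z.
Proof.
rewrite /padic_dist -(subrKA y x (- z)); apply: le_trans (padic_absD _ _) _.
by rewrite ge_max lerDl lerDr !padic_abs_ge0.
Qed.

HB.instance Definition _ := isMetric.Build rat (padic p_pr)
  padic_distxx padic_dist_positivity padic_dist_sym padic_dist_triangle.

HB.instance Definition _ := isPointed.Build (padic p_pr) 0.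

Local Notation borel := (<<s @open (padic p_pr) >>).

Fact padic_borel0 : borel set0.
Proof. exact: (@measurable0 _ (g_sigma_algebraType (@open (padic p_pr)))). Qed.
Fact padic_borelC A : borel A -> borel (~` A).
Proof. exact: (@measurableC _ (g_sigma_algebraType (@open (padic p_pr)))). Qed.
Fact padic_borel_bigcup (F : (set (padic p_pr))^nat) :
  (forall i, borel (F i)) -> borel (\bigcup_i F i).
Proof.
exact: (@bigcupT_measurable _ (g_sigma_algebraType (@open (padic p_pr)))).
Qed.

HB.instance Definition _ :=
  @isMeasurable.Build (sigma_display (@open (padic p_pr))) (padic p_pr)
    borel padic_borel0 padic_borelC padic_borel_bigcup.

Definition Zp : set (padic p_pr) := [set x | padic_abs x <= 1].

Lemma ZpE : Zp = range tofrac.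
Proof.
apply/seteqP; split => [x|_ [a _ <-]]; last first.
  rewrite /Zp /= padic_abs_tofrac.
  have -> : (1 : rat) = p%:R ^- 0 by rewrite expr0 invr1.
  by rewrite padic_int_abs_le padic_res0.
elim/padic_ind: x => a b b0; rewrite /Zp /= padic_abs_frac //.
rewrite ler_pdivrMr ?mul1r ?lt0r ?padic_int_abs_eq0 ?b0 ?padic_int_abs_ge0 //.
rewrite [padic_int_abs b]/padic_int_abs (negbTE b0) padic_int_abs_le.
have [] := padic_int_valP b0.
move: (padic_int_val b) => v bv bSv /eqP /padic_valK [a' ea]; have [b' eb] := padic_valK bv.
have [|c cb] := @padic_unitP _ _ b'.
  move=> b'1; have [y ey] := @padic_valK _ _ b' 1 b'1.
  apply: bSv; rewrite eb ey mulrA -exprD addn1 -natrX padic_mulE padic_natE.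
  by rewrite modnn mul0n mod0n.
exists (c * a') => //; apply/eqP.
rewrite eq_sym -[X in _ == X]divr1 -tofrac1 eqr_div ?tofrac_eq0 ?oner_neq0 //.
rewrite -!tofracM tofrac_eq mulr1 ea eb.
move: (p%:R ^+ v) => q.
by rewrite -[eqbLHS]mulr1 -cb mulrACA [eqbRHS]mulrACA [c * _]mulrC.
Qed.

End PadicAbs.

Arguments Zp {p} p_pr _.

(* [mu] is the Haar measure on [Z_p] normalized to be a probability measure,
   seen as a measure on [Q_p] carried by [Z_p]. *)
Definition normalized_haar_Zp p (p_pr : prime p) (R : realType)
    (mu : set (padic p_pr) -> \bar R) : Prop :=
  [/\ mu (Zp p_pr) = 1%E, mu (~` Zp p_pr) = 0%E &
      forall a B, Zp p_pr a -> measurable B -> B `<=` Zp p_pr ->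
        mu [set a + x | x in B] = mu B].

Definition standard_padic_gaussian p (p_pr : prime p) (R : realType)
    (disp : measure_display) (Omega : measurableType disp)
    (P : probability Omega R) (X : {RV P >-> padic p_pr}) : Prop :=
  normalized_haar_Zp (distribution P X).

Definition mutually_independent (I : finType) (R : realType)
    (disp disp' : measure_display) (Omega : measurableType disp)
    (E : measurableType disp') (P : probability Omega R)
    (X : I -> {RV P >-> E}) : Prop :=
  forall (J : {set I}) (B : I -> set E), (forall i, measurable (B i)) ->
    P (\bigcap_(i in [set` J]) (X i @^-1` B i)) =
    (\prod_(i in J) P (X i @^-1` B i))%E.

Definition gen_binom (F : fieldType) (t : F) (m : nat) : F :=
  (\prod_(j < m) (t - j%:R)) / m`!%:R.

(* [k j] ranges over ['I_N.+1], i.e. over {0, 1, ..., N} *)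
Definition binom_poly (F : fieldType) (d N : nat)
    (z : {ffun 'I_d -> 'I_N.+1} -> F) (t : 'rV[F]_d) : F :=
  \sum_(k : {ffun 'I_d -> 'I_N.+1}) z k * \prod_(j < d) gen_binom (t 0 j) (k j).

Definition common_zeros p (p_pr : prime p) (d N : nat)
    (z : 'I_d -> {ffun 'I_d -> 'I_N.+1} -> padic p_pr) :
    set 'rV[padic p_pr]_d :=
  [set t : 'rV[padic p_pr]_d |
    (forall j, Zp p_pr (t 0 j)) /\ (forall i, binom_poly (z i) t = 0)].

(* real logarithm of [x] to base [b] *)
Definition logb (R : realType) (b x : R) : R := ln x / ln b.

(* Main.v *)
Require Import Defs.
From HB Require Import structures.
From mathcomp Require Import all_boot all_order all_algebra.
From mathcomp Require Import all_classical all_reals all_analysis.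
From mathcomp Require Import measurable_realfun.
From mathcomp Require Import zify ring lra.

Set Implicit Arguments.
Unset Strict Implicit.
Unset Printing Implicit Defensive.

Import Order.TTheory GRing.Theory Num.Theory.
Import numFieldNormedType.Exports.

Local Open Scope ring_scope.

(** Let [p ^ n <= N < p ^ n.+1]. The binomial functions of index at most [N]
    are Lipschitz on [Z_p] with constant [p ^ n], and after the rescaling
    [h = p ^ n * u] of the increment they have a first order expansion with
    integral slope and quadratic error ([bin_expand]). Moreover the slope of the
    function of index [p ^ n] is a unit ([bin_slope_pX]). Hence at each point
    [c] the value [F] of the random system (a column of size [d]) and its
    rescaled Jacobian matrix [A] (of size [d]) are jointly uniform modulo powers
    of [p] ([jet_surj], [jet_uniform]).

    Cut [Z_p ^ d] into the [p ^ (d * (n + l))] boxes of radius [p ^ - (n + l)].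
    A zero in the box of [c] forces the linearized equation
    [F + p ^ l * A * v = 0] to be solvable modulo [p ^ (2 * l)]
    ([zero_in_solvable]), and conversely Newton's iteration turns such a
    solution into a zero as soon as [A] divides [p ^ (l - 1)] modulo [p ^ l]
    ([newton], [solvable_zero_in]); the probability that it does not is
    [O(p ^ - l)] ([quasi_inverse], [card_singular]). Solvability means that [F]
    is [p ^ l * U] with [U] in the image of [A] modulo [p ^ l], so a box
    contains a zero with probability close to
    [p ^ - (d * l) * Prob (U in the image of A)], and the expected number of
    boxes that do is close to [p ^ (d * n) * Prob (U in the image of A)]
    ([expected_hits_bounds]).

    The last probability is a symmetry argument. Form the uniform
    [d * (1 + d)] matrix [W = (U | A)]. Outside an event of small probability
    its kernel has exactly one direction modulo [p], a point of the projective
    space of dimension [d] over [F_p]; by invariance under [GL] this point is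
    uniform ([card_has_ker]); and [U] is in the image of [A] exactly when this
    point lies in the affine chart where the first coordinate does not vanish.
    Hence the probability tends to
    [p ^ d / (1 + p + ... + p ^ d)] ([solvable_prob_near]).

    Finally the number of boxes that contain a zero increases with [l] to the
    number of zeros ([counting_hits]), so that the theorem follows by monotone
    convergence. By compactness of [Z_p ^ d] a box contains a zero if and only
    if it contains points of [nat ^ d] where the system is arbitrarily small
    ([hitP]), which is a measurable condition on the coefficients. *)

(** * Congruences in a commutative ring *)

Section Congruence.
Context (R : comPzRingType).
Implicit Types e x y z : R.

(** Stated by divisibility in an arbitrary ring, so that it can be transported by
    ring morphisms from the integers to the [p]-adic integers. *)
Definition cong e x y : Prop := exists w, x = y + e * w.

Lemma cong_refl e x : cong e x x.
Proof. by exists 0; rewrite mulr0 addr0. Qed.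

Lemma cong_sym e x y : cong e x y -> cong e y x.
Proof. by case=> w ->; exists (- w); rewrite mulrN addrK. Qed.

Lemma cong_trans e y x z : cong e x y -> cong e y z -> cong e x z.
Proof. by move=> [v ->] [w ->]; exists (w + v); rewrite mulrDr addrA. Qed.

Lemma congD e x y x' y' : cong e x y -> cong e x' y' -> cong e (x + x') (y + y').
Proof. by move=> [v ->] [w ->]; exists (v + w); rewrite mulrDr addrACA. Qed.

Lemma congM e x y x' y' : cong e x y -> cong e x' y' -> cong e (x * x') (y * y').
Proof.
move=> [v ->] [w ->]; exists (y * w + v * y' + e * v * w).
by ring.
Qed.

Lemma cong_weaken e f x y : cong (e * f) x y -> cong e x y.
Proof. by case=> w ->; exists (f * w); rewrite mulrA. Qed.

Lemma cong_scale e f x y : cong e x y -> cong (f * e) (f * x) (f * y).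
Proof. by case=> w ->; exists w; rewrite mulrDr mulrA. Qed.

Lemma cong_sum (I : Type) (r : seq I) (Q : pred I) e (F G : I -> R) :
  (forall i, Q i -> cong e (F i) (G i)) ->
  cong e (\sum_(i <- r | Q i) F i) (\sum_(i <- r | Q i) G i).
Proof.
by move=> FG; apply: (big_ind2 (cong e)) => //; [exact: cong_refl | exact: congD].
Qed.

Lemma cong_prod (I : Type) (r : seq I) (Q : pred I) e (F G : I -> R) :
  (forall i, Q i -> cong e (F i) (G i)) ->
  cong e (\prod_(i <- r | Q i) F i) (\prod_(i <- r | Q i) G i).
Proof.
by move=> FG; apply: (big_ind2 (cong e)) => //; [exact: cong_refl | exact: congM].
Qed.

(** Leibniz rule to first order: the error is a multiple of the square of the
    increment. *)
Lemma cong_prod_expand (I : eqType) (r : seq I) e (x y : I -> R) : uniq r ->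
  cong (e * e) (\prod_(i <- r) (x i + e * y i))
    (\prod_(i <- r) x i + e * \sum_(i <- r) y i * \prod_(j <- r | j != i) x j).
Proof.
elim: r => [_|a r IH /= /andP[ar ur]].
  by rewrite !big_nil mulr0 addr0; exact: cong_refl.
rewrite !big_cons eqxx /=; have [w ->] := IH ur.
have -> : \prod_(j <- r | j != a) x j = \prod_(j <- r) x j.
  rewrite big_seq_cond [RHS]big_seq; apply: eq_bigl => j.
  by case: (boolP (j \in r)) => //= jr; apply: contraNneq ar => <-.
have -> : \sum_(i <- r) y i * \prod_(j <- a :: r | j != i) x j =
   x a * \sum_(i <- r) y i * \prod_(j <- r | j != i) x j.
  rewrite mulr_sumr big_seq [RHS]big_seq; apply: eq_bigr => i ir.
  by rewrite big_cons ifT 1?mulrCA //; apply: contraNneq ar => ->.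
set X := \prod_(_ <- _) _; set Y := \sum_(_ <- _) _.
exists (x a * w + y a * Y + e * y a * w); by ring.
Qed.

End Congruence.

Lemma cong_map (R S : comPzRingType) (f : {rmorphism R -> S}) (e x y : R) :
  cong e x y -> cong (f e) (f x) (f y).
Proof. by case=> w ->; exists (f w); rewrite rmorphD rmorphM. Qed.

(** * Binomial coefficients modulo powers of a prime *)

Section BinomialCongruences.
Context (p : nat) (p_pr : prime p).
Local Notation pX e := ((p%:R : int) ^+ e).

Let p_gt0 : (0 < p)%N. Proof. exact: prime_gt0. Qed.
Let pX_gt0 n : (0 < p ^ n)%N. Proof. by rewrite expn_gt0 p_gt0. Qed.

Lemma cong_intP (e : nat) (x y : int) :
  cong (pX e) x y <-> (p ^ e %| `|x - y|)%N.
Proof.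
rewrite -natrX natz; split.
  by case=> w ->; rewrite addrAC subrr add0r abszM dvdn_mulr.
by move=> h; have /dvdzP [w hw] : ((p ^ e)%:Z %| x - y)%Z by []; exists w; rewrite mulrC -hw subrKC.
Qed.

(** Dividing a congruence by a positive integer below [p ^ n.+1] costs at most
    [n] powers of [p]. *)
Lemma cong_cancel n e i (x y : int) : (0 < i < p ^ n.+1)%N ->
  cong (pX (n + e)) (i%:R * x) (i%:R * y) -> cong (pX e) x y.
Proof.
case/andP=> i0 iN; rewrite !cong_intP -mulrBr abszM natz absz_nat.
move: `|x - y|%N => z; have [->|z0] := posnP z; first by rewrite dvdn0.
rewrite !pfactor_dvdn ?muln_gt0 ?i0 // lognM //.
have : (logn p i <= n)%N.
  rewrite leqNgt; apply/negP => h; move: iN; rewrite ltnNge => /negP; apply.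
  by apply: leq_trans (dvdn_leq i0 (pfactor_dvdnn p i)); rewrite leq_exp2l ?prime_gt1.
lia.
Qed.

Lemma binSz (h i : nat) :
  (i.+1%:R : int) * 'C(h, i.+1)%:R = h%:R * 'C(h.-1, i)%:R.
Proof. by rewrite -!natrM mul_bin_diag. Qed.

Lemma Vandermonde_shift (s h k : nat) : 'C(s + h, k) =
  ('C(s, k) + \sum_(i < k) 'C(h, i.+1) * 'C(s, k - i.+1))%N.
Proof.
by rewrite addnC -binomial.Vandermonde big_ord_recl /= bin0 mul1n subn0.
Qed.

Lemma bin_dvd n e u i : (i.+1 < p ^ n.+1)%N ->
  (p ^ e %| 'C(p ^ (n + e) * u, i.+1))%N.
Proof.
move=> iN; have := @cong_cancel n e i.+1 'C(p ^ (n + e) * u, i.+1)%:R 0 iN.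
rewrite !cong_intP !subr0 mulr0 subr0 binSz !natz !abszM !absz_nat; apply.
by rewrite -mulnA dvdn_mulr.
Qed.

(** The binomial functions are Lipschitz with constant [p ^ n], because
    [C(h, i)] is [h / i * C(h - 1, i - 1)] and [i < p ^ n.+1]. *)
Lemma bin_cong n e k s u : (k < p ^ n.+1)%N ->
  cong (pX e) ('C(s + p ^ (n + e) * u, k)%:R) ('C(s, k)%:R).
Proof.
move=> kN; apply/cong_intP; rewrite Vandermonde_shift natrD addrAC subrr add0r.
rewrite natz absz_nat.
apply: dvdn_sum => i _; rewrite dvdn_mulr // bin_dvd //.
exact: leq_ltn_trans kN.
Qed.

(** The derivative of the binomial function of index [k], rescaled by [p ^ n]
    and approximated by the difference quotient of step [p ^ (n + l)]. *)
Definition bin_slope n l k s : nat :=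
  \sum_(i < k) ('C(p ^ (n + l), i.+1) %/ p ^ l) * 'C(s, k - i.+1).

Lemma bin_slope0 n l s : bin_slope n l 0 s = 0%N.
Proof. exact: big_ord0. Qed.

Lemma bin_slope_cong n l k s u : (k < p ^ n.+1)%N ->
  cong (pX l) (bin_slope n l k (s + p ^ (n + l) * u))%:R (bin_slope n l k s)%:R.
Proof.
move=> kN; rewrite /bin_slope !natr_sum; apply: cong_sum => i _.
rewrite !natrM; apply: congM; first exact: cong_refl.
by apply: bin_cong; apply: leq_ltn_trans kN; apply: leq_subr.
Qed.

(** First order expansion. The increment [h] is at least as small as the step
    of [bin_slope], and for two such increments [h, h'] one has
    [C(h, i) / h = C(h', i) / h'] modulo [p ^ l / i], as both sides are
    values of the Lipschitz function [C(h - 1, i - 1)] divided by [i]. *)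
Lemma bin_expand n l j k s u : (k < p ^ n.+1)%N -> (l <= j)%N ->
  cong (pX (j + l)) ('C(s + p ^ (n + j) * u, k)%:R)
    ('C(s, k)%:R + pX j * (u%:R * (bin_slope n l k s)%:R)).
Proof.
move=> kN lj; rewrite Vandermonde_shift natrD; apply: congD.
  exact: cong_refl.
rewrite /bin_slope !natr_sum !mulr_sumr; apply: cong_sum => i _.
rewrite !natrM !mulrA; apply: congM; last exact: cong_refl.
have iN : (i.+1 < p ^ n.+1)%N by exact: leq_ltn_trans kN.
set c := ('C(p ^ (n + l), i.+1) %/ p ^ l)%N.
have ec : (i.+1 * c = p ^ n * 'C((p ^ (n + l)).-1, i))%N.
  apply/eqP; rewrite -(eqn_pmul2r (pX_gt0 l)) -mulnA divnK; last first.
    by have := @bin_dvd n l 1 i iN; rewrite muln1.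
  by rewrite -mul_bin_diag mulnAC -expnD.
apply: (@cong_cancel n (j + l) i.+1) => //.
rewrite binSz.
have -> : i.+1%:R * (pX j * u%:R * c%:R) =
    (pX (n + j) * u%:R) * 'C((p ^ (n + l)).-1, i)%:R.
  transitivity (pX j * u%:R * (i.+1 * c)%:R); first by rewrite natrM; ring.
  by rewrite ec natrM natrX exprD; ring.
rewrite natrM natrX.
have [->|u0] := posnP u; first by rewrite mulr0 !mul0r; exact: cong_refl.
rewrite [X in cong X](_ : _ = pX (n + j) * pX l); last by rewrite !exprD; ring.
rewrite -!mulrA; apply: cong_scale; apply: congM; first exact: cong_refl.
have -> : (p ^ (n + j) * u)%N.-1 =
    ((p ^ (n + l)).-1 + p ^ (n + l) * (p ^ (j - l) * u).-1)%N.
  have : (0 < p ^ (j - l) * u)%N by rewrite muln_gt0 pX_gt0.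
  have -> : (p ^ (n + j) = p ^ (n + l) * p ^ (j - l))%N by rewrite -expnD; congr expn; lia.
  have := pX_gt0 (n + l); nia.
by apply: bin_cong; exact: ltn_trans iN.
Qed.

(** By Pascal's rule, since [p] divides [C(p ^ e, m)] for [0 < m < p ^ e]. *)
Lemma bin_pred_pX e m : (m < p ^ e)%N -> ~~ (p %| 'C((p ^ e).-1, m))%N.
Proof.
elim: m => [|m IH] me; first by rewrite bin0 dvdn1 neq_ltn prime_gt1 ?orbT.
have := IH (ltnW me); apply: contra => h.
case: e {IH} me h => [|e] me h; first by rewrite expn0 in me.
have := @bin_dvd e 1 1 m me; rewrite expn1 muln1 addn1.
by rewrite -{1}(prednK (pX_gt0 e.+1)) binS dvdn_addr.
Qed.

(** In the index [p ^ n] the last summand is a binomial coefficient of the form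
    [C(p ^ e - 1, m)], the others are divisible by [p]. *)
Lemma bin_slope_pX n l s : ~~ (p %| bin_slope n l (p ^ n) s)%N.
Proof.
rewrite /bin_slope; have := pX_gt0 n; case E : (p ^ n)%N => [//|m] _.
rewrite big_ord_recr /= subnn bin0 muln1 dvdn_addr; last first.
  apply: dvdn_sum => i _; rewrite dvdn_mulr //.
  case: n E => [|n] E; first by move: (ltn_ord i); case: E => {2}<-; rewrite ltn0.
  have iN : (i.+1 < p ^ n.+1)%N by rewrite E ltnS.
  have := @bin_dvd n l.+1 1 i iN; rewrite muln1 addnS -addSn => h.
  rewrite dvdn_divRL -?expnS //.
  by apply: dvdn_trans h; rewrite dvdn_exp2l.
have -> : ('C(p ^ (n + l), m.+1) %/ p ^ l = 'C((p ^ (n + l)).-1, m))%N.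
  apply/eqP; rewrite -(eqn_pmul2r (pX_gt0 l)) divnK; last first.
    have mN : (m.+1 < p ^ n.+1)%N by rewrite -E ltn_exp2l ?prime_gt1.
    by have := @bin_dvd n l 1 m mN; rewrite muln1.
  rewrite -(eqn_pmul2l (pX_gt0 n)) [X in (X * 'C(_, m.+1))%N]E -mul_bin_diag.
  by rewrite [('C(_, m) * _)%N]mulnC mulnA -expnD.
by apply: bin_pred_pX; rewrite -E leq_exp2l ?prime_gt1 // leq_addr.
Qed.

Section Multi.
Context (d N n : nat) (N_lt : (N < p ^ n.+1)%N).
Implicit Types (k : {ffun 'I_d -> 'I_N.+1}) (s u : 'I_d -> nat).

Definition bin_prod k s : nat := \prod_(j < d) 'C(s j, k j).

(** The partial derivative of [bin_prod k] along the coordinate [i], rescaled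
    like [bin_slope]. *)
Definition bin_prod_slope l k s i : nat :=
  bin_slope n l (k i) (s i) * \prod_(j < d | j != i) 'C(s j, k j).

Let k_lt k j : (k j < p ^ n.+1)%N.
Proof. exact: leq_ltn_trans (leq_ord _) N_lt. Qed.

Lemma bin_prod_cong e k s u :
  cong (pX e) (bin_prod k (fun j => s j + p ^ (n + e) * u j)%N)%:R (bin_prod k s)%:R.
Proof.
by rewrite /bin_prod !natr_prod; apply: cong_prod => j _; exact: bin_cong.
Qed.

Lemma bin_prod_slope_cong l k s u i :
  cong (pX l) (bin_prod_slope l k (fun j => s j + p ^ (n + l) * u j)%N i)%:R
    (bin_prod_slope l k s i)%:R.
Proof.
rewrite /bin_prod_slope !natrM !natr_prod; apply: congM.
  exact: bin_slope_cong.
by apply: cong_prod => j _; exact: bin_cong.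
Qed.

(** The error of the product rule is of order [p ^ (2 * j)], hence it is
    absorbed as [l <= j]. *)
Lemma bin_prod_expand l j k s u : (l <= j)%N ->
  cong (pX (j + l)) (bin_prod k (fun i => s i + p ^ (n + j) * u i)%N)%:R
    ((bin_prod k s)%:R + pX j * \sum_i (u i)%:R * (bin_prod_slope l k s i)%:R).
Proof.
move=> lj; rewrite /bin_prod !natr_prod.
apply: cong_trans.
  by apply: cong_prod => i _; exact: (bin_expand (s i) (u i) (k_lt k i) lj).
have lejj : (j + j = j + l + (j - l))%N by lia.
have := cong_prod_expand (pX j) (fun i => 'C(s i, k i)%:R)
  (fun i => (u i)%:R * (bin_slope n l (k i) (s i))%:R) (index_enum_uniq 'I_d).
rewrite -exprD lejj exprD => /cong_weaken.
congr cong; congr (_ + _ * _); apply: eq_bigr => i _.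
by rewrite /bin_prod_slope natrM natr_prod mulrA.
Qed.

End Multi.

End BinomialCongruences.

(** * Kernel directions of matrices over a finite local ring *)

HB.instance Definition _ (I : finType) (V : finZmodType) :=
  GRing.Zmodule.on {ffun I -> V}.
HB.instance Definition _ (U V : finZmodType) := GRing.Zmodule.on (U * V)%type.

(** The image of a uniform element under a surjective morphism is uniform: the
    fibres are translates of each other. *)
Lemma card_surj_preim (G H : finZmodType) (f : G -> H) (S : {pred H}) :
  {morph f : x y / x + y} -> (forall y, exists x, f x = y) ->
  (#|[pred x | f x \in S]| * #|H| = #|S| * #|G|)%N.
Proof.
move=> fD fsurj.
have fib y : #|[pred x | f x == y]| = #|[pred x | f x == 0]|.
  have [a <-] := fsurj y.
  rewrite -(fintype.card_image (@addIr _ a) [pred x | f x == 0]).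
  apply: eq_card => x; rewrite !inE; apply/eqP/fintype.imageP => [fx|[z /eqP fz ->]].
    exists (x - a); rewrite ?subrK // inE; apply/eqP.
    by apply: (addIr (f a)); rewrite -fD subrK add0r.
  by rewrite fD fz add0r.
have card_f (T : {pred H}) : #|[pred x | f x \in T]| = (#|T| * #|[pred x | f x == 0%R]|)%N.
  rewrite -sum1_card (partition_big f (mem T)) //= -sum_nat_const.
  apply: eq_bigr => y yT; rewrite -(fib y) -sum1_card; apply: eq_bigl => x.
  by rewrite !inE; case: eqP => [->|]; rewrite ?andbT ?andbF.
have -> : #|G| = (#|H| * #|[pred x | f x == 0%R]|)%N.
  by rewrite -card_f; apply: eq_card => x; rewrite !inE.
by rewrite card_f; lia.
Qed.

Section LocalRing.
Context (R : finComUnitRingType) (F : finFieldType) (rho : {rmorphism R -> F}).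
Hypothesis rho_surj : forall a, exists x, rho x = a.
Hypothesis rho_unit : forall x, rho x != 0 -> x \is a GRing.unit.

Lemma lift_mx m n (A : 'M[F]_(m, n)) : exists B, map_mx rho B = A.
Proof.
have [s hs] := fin_all_exists rho_surj.
by exists (map_mx s A); apply/matrixP => i j; rewrite !mxE hs.
Qed.

(** The set of the kernel directions modulo the maximal ideal is a subset of
    the projective space over the residue field. *)
Definition has_ker d (x : 'cV[F]_(1 + d)) : pred 'M[R]_(d, 1 + d) :=
  fun W => [exists w, (map_mx rho w == x) && (W *m w == 0)].

Lemma has_ker_scale d (x : 'cV[F]_(1 + d)) W c :
  has_ker x W -> has_ker (c *: x) W.
Proof.
have [s <-] := rho_surj c.
case/existsP => w /andP[/eqP <- /eqP Ww]; apply/existsP; exists (s *: w).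
by rewrite map_mxZ eqxx -scalemxAr Ww scaler0 eqxx.
Qed.

Lemma col_of_unitmx m (x : 'cV[F]_m.+1) : x != 0 ->
  exists2 g, g \in unitmx & g *m delta_mx 0 0 = x.
Proof.
move=> x0; have rx : \rank x = 1%N.
  by apply/eqP; rewrite eqn_leq rank_leq_col lt0n mxrank_eq0.
have := mulmx_ebase x; rewrite rx [row_ebase x]mx11_scalar mul_mx_scalar => ex.
have c0 : row_ebase x 0 0 != 0.
  have := row_ebase_unit x; rewrite [row_ebase x]mx11_scalar.
  by rewrite unitmxE det_scalar1 mxE eqxx mulr1n unitfE.
exists (row_ebase x 0 0 *: col_ebase x).
  by rewrite unitmxZ ?unitfE ?col_ebase_unit.
rewrite -scalemxAl -[RHS]ex; congr (_ *: (_ *m _)).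
by apply/matrixP => i j; rewrite !mxE !ord1 andbT; case: i => -[|i] ? //=.
Qed.

(** A matrix over the residue field that maps [x] to [y] lifts to an invertible
    matrix over the local ring, which carries kernels to kernels. *)
Lemma card_has_ker_le d (x y : 'cV[F]_(1 + d)) : x != 0 -> y != 0 ->
  (#|has_ker x| <= #|has_ker y|)%N.
Proof.
move=> /col_of_unitmx[g gu gx] /col_of_unitmx[h hu hy].
pose k := h *m invmx g.
have kx : k *m x = y by rewrite -gx -mulmxA mulKmx.
have ku : k \in unitmx by rewrite unitmx_mul hu unitmx_inv.
have [K eK] := lift_mx k.
have Ku : K \in unitmx.
  rewrite unitmxE; apply: rho_unit; rewrite -det_map_mx eK -unitfE.
  by rewrite -unitmxE.
have inj : injective (mulmxr (invmx K) : 'M[R]_(d, 1 + d) -> 'M[R]_(d, 1 + d)).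
  by move=> U V /= /(congr1 (mulmxr K)) /=; rewrite !mulmxKV.
rewrite -(fintype.card_image inj); apply: fintype.subset_leq_card; apply/fintype.subsetP => V.
case/fintype.imageP => W /existsP[w /andP[/eqP wx /eqP Ww]] ->.
apply/existsP; exists (K *m w); rewrite map_mxM eK wx kx eqxx /=.
by rewrite -mulmxA mulKmx // Ww.
Qed.

(** All directions are equally likely, because the group [GL] of the ring acts
    transitively on them. *)
Lemma card_has_ker d (x y : 'cV[F]_(1 + d)) : x != 0 -> y != 0 ->
  #|has_ker x| = #|has_ker y|.
Proof. by move=> x0 y0; apply/eqP; rewrite eqn_leq !card_has_ker_le. Qed.

Section Count.
Context (d : nat) (Bad : pred 'M[R]_(d, 1 + d)).
Hypothesis ker_ex : forall W, exists2 x : 'cV[F]_(1 + d), x != 0 & has_ker x W.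
Hypothesis ker_uniq : forall W (x y : 'cV[F]_(1 + d)), ~~ Bad W -> x != 0 ->
  has_ker x W -> has_ker y W -> exists c, y = c *: x.

Let b := #|Bad|.
Let M := #|{: 'M[R]_(d, 1 + d)}|.
Let P := #|F|.
Let e0 : 'cV[F]_(1 + d) := delta_mx 0 0.
Let kappa := #|has_ker e0|.

Let e0_neq0 : e0 != 0.
Proof.
apply/eqP => /matrixP /(_ 0 0); rewrite !mxE eqxx => /eqP.
by rewrite oner_eq0.
Qed.

Let ndir W := #|[pred x : 'cV[F]_(1 + d) | (x != 0) && has_ker x W]|.

Let ndir_ge W : (P.-1 <= ndir W)%N.
Proof.
have [x x0 hx] := ker_ex W.
have inj : injective (fun c : F => c *: x).
  by move=> a c /eqP; rewrite -subr_eq0 -scalerBl scaler_eq0 (negbTE x0) orbF subr_eq0 => /eqP.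
have <- : #|[pred c : F | c != 0]| = P.-1 by rewrite -(cardC1 (0 : F)).
rewrite -(fintype.card_image inj); apply: fintype.subset_leq_card; apply/fintype.subsetP => y.
case/fintype.imageP => c; rewrite inE => c0 ->.
by rewrite inE scaler_eq0 negb_or x0 c0 has_ker_scale.
Qed.

Let ndir_le W : (ndir W <= P.-1 + P ^ d.+1 * Bad W)%N.
Proof.
case: (boolP (Bad W)) => BW.
  rewrite muln1; apply: leq_trans (leq_addl _ _).
  by apply: leq_trans (max_card _) _; rewrite card_mx muln1.
rewrite muln0 addn0.
have [x x0 hx] := ker_ex W.
have <- : #|[pred c : F | c != 0]| = P.-1 by rewrite -(cardC1 (0 : F)).
apply: leq_trans (leq_image_card (fun c => c *: x) _).
apply: fintype.subset_leq_card; apply/fintype.subsetP => y; rewrite inE => /andP[y0 hy].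
have [c ec] := ker_uniq BW x0 hx hy; apply/fintype.imageP; exists c => //.
by rewrite inE; apply: contraNneq y0 => c0; rewrite ec c0 scale0r.
Qed.

Let sum_dir : (\sum_W ndir W = (P ^ d.+1).-1 * kappa)%N.
Proof.
rewrite /ndir; under eq_bigr do rewrite -sum1_card big_mkcondr /=.
rewrite exchange_big /=.
under eq_bigr => x x0 do rewrite -big_mkcond sum1_card (card_has_ker x0 e0_neq0).
rewrite sum_nat_const; congr (_ * _)%N.
have -> : (P ^ d.+1)%N = #|{: 'cV[F]_(1 + d)}| by rewrite card_mx muln1.
by rewrite -(cardC1 (0 : 'cV[F]_(1 + d))).
Qed.

(** This lemma and the next count the pairs of a matrix and a nonzero vector in
    one of its kernel directions in two ways. *)
Lemma card_has_ker_lower : (P.-1 * M <= (P ^ d.+1).-1 * kappa)%N.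
Proof.
rewrite -sum_dir [(_ * M)%N]mulnC -sum_nat_const; apply: leq_sum => W _.
exact: ndir_ge.
Qed.

Lemma card_has_ker_upper :
  ((P ^ d.+1).-1 * kappa <= P.-1 * M + P ^ d.+1 * b)%N.
Proof.
rewrite -sum_dir.
apply: (@leq_trans (\sum_(W : 'M[R]_(d, 1 + d)) (P.-1 + P ^ d.+1 * Bad W))%N).
  by apply: leq_sum => W _; exact: ndir_le.
rewrite big_split /= sum_nat_const mulnC leq_add2l -big_distrr /= leq_mul2l.
apply/orP; right; rewrite /b -sum1_card big_mkcond /=.
apply: eq_leq; rewrite [RHS]big_mkcond /=.
by apply: eq_bigr => W _; rewrite unfold_in; case: (Bad W).
Qed.

(** The kernel directions in the affine chart where the first coordinate does
    not vanish. *)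
Definition affine_ker : pred 'M[R]_(d, 1 + d) :=
  fun W => [exists y : 'cV[F]_d, has_ker (col_mx 1 y : 'cV[F]_(1 + d)) W].

Let naff W := #|[pred y : 'cV[F]_d | has_ker (col_mx 1 y : 'cV[F]_(1 + d)) W]|.

Let col1_neq0 (y : 'cV[F]_d) : (col_mx 1 y : 'cV[F]_(1 + d)) != 0.
Proof. by rewrite col_mx_eq0 oner_eq0. Qed.

Let sum_aff : (\sum_W naff W = P ^ d * kappa)%N.
Proof.
rewrite /naff; under eq_bigr do rewrite -sum1_card big_mkcond /=.
rewrite exchange_big /=.
under eq_bigr => y _ do rewrite -big_mkcond sum1_card (card_has_ker (col1_neq0 y) e0_neq0).
by rewrite sum_nat_const; congr (_ * _)%N; rewrite card_mx muln1.
Qed.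

Lemma card_affine_ker_le : (#|affine_ker| <= P ^ d * kappa)%N.
Proof.
rewrite -sum_aff -sum1_card big_mkcond; apply: leq_sum => W _.
rewrite unfold_in; case: ifP => // /existsP[y hy].
by apply/card_gt0P; exists y.
Qed.

(** A matrix outside [Bad] has at most one kernel direction in the chart. *)
Lemma card_affine_ker_ge : (P ^ d * kappa <= #|affine_ker| + P ^ d * b)%N.
Proof.
rewrite -sum_aff.
have -> : (#|affine_ker| + P ^ d * b = \sum_W (affine_ker W + P ^ d * Bad W))%N.
  rewrite big_split /= -big_distrr /=; congr (_ + _ * _)%N.
    rewrite -sum1_card big_mkcond /=; apply: eq_bigr => W _.
    by rewrite unfold_in -/(affine_ker W); case: (affine_ker W).
  rewrite /b -sum1_card [LHS]big_mkcond /=; apply: eq_bigr => W _.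
  by rewrite unfold_in; case: (Bad W).
apply: leq_sum => W _; case: (boolP (Bad W)) => BW.
  rewrite muln1; apply: leq_trans (leq_addl _ _).
  by apply: leq_trans (max_card _) _; rewrite card_mx muln1.
rewrite muln0 addn0; have [_|h] := boolP (affine_ker W); last first.
  rewrite leqn0 -/(naff W); apply/eqP; apply: eq_card0 => y.
  by apply/negbTE; apply: contra h => hy; apply/existsP; exists y.
apply/card_le1_eqP => y z /= hy hz.
have [c] := ker_uniq BW (col1_neq0 y) hy hz.
rewrite scale_col_mx => /eq_col_mx[e1 ->].
suff -> : c = 1 by rewrite scale1r.
by move/matrixP: e1 => /(_ 0 0); rewrite !mxE mulr1.
Qed.

End Count.

End LocalRing.

(** * Matrices over the integers modulo a prime power *)

Section Reduction.
Context (a b : nat) (a_gt1 : (1 < a)%N) (b_gt1 : (1 < b)%N) (dvd_ab : (a %| b)%N).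

Lemma Zp_natr_eq0 n : ((n%:R : 'Z_a) == 0) = (a %| n)%N.
Proof. by rewrite -val_eqE /= val_Zp_nat. Qed.

Lemma Zp_intr_eq0 (z : int) : ((z%:~R : 'Z_a) == 0) = (a %| `|z|)%N.
Proof.
by case: z => n; rewrite ?NegzE ?mulrNz ?oppr_eq0 -pmulrn Zp_natr_eq0 // abszN.
Qed.

Lemma Zp_natr_eq m n : ((m%:R : 'Z_a) == n%:R) = (m == n %[mod a])%N.
Proof. by rewrite -val_eqE /= !val_Zp_nat. Qed.

Lemma card_Zq : #|{: 'Z_b}| = b.
Proof. by rewrite card_ord Zp_cast. Qed.

(** Opaque, since a ring morphism between these two rings is unique. *)
Lemma reduction : {rmorphism 'Z_b -> 'Z_a}.
Proof.
pose f (x : 'Z_b) : 'Z_a := (x : nat)%:R.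
have f_nat n : f n%:R = n%:R.
  by apply/eqP; rewrite /f Zp_natr_eq val_Zp_nat // modn_dvdm.
have fD : {morph f : x y / x + y}.
  by move=> x y; rewrite -[x]natr_Zp -[y]natr_Zp -natrD !f_nat natrD.
have fB : zmod_morphism f.
  by move=> x y; apply: (addIr (f y)); rewrite -fD !subrK.
have fM : monoid_morphism f.
  split=> [|x y]; first by have := f_nat 1; rewrite !mulr1n.
  by rewrite -[x]natr_Zp -[y]natr_Zp -natrM !f_nat natrM.
exact: (HB.pack f (GRing.isZmodMorphism.Build 'Z_b 'Z_a f fB)
  (GRing.isMonoidMorphism.Build 'Z_b 'Z_a f fM)).
Qed.

End Reduction.

Lemma unitmx_map (A B : comUnitRingType) (f : {rmorphism A -> B}) n (M : 'M[A]_n) :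
  M \in unitmx -> map_mx f M \in unitmx.
Proof. by rewrite !unitmxE det_map_mx; exact: rmorph_unit. Qed.

Section PrimePower.
Context (p : nat) (p_pr : prime p) (l : nat) (l_gt0 : (0 < l)%N).
Local Notation q := (p ^ l)%N.
Local Notation R := 'Z_(p ^ l).

Let q_gt1 : (1 < q)%N.
Proof. by rewrite -(exp1n l) ltn_exp2r ?prime_gt1. Qed.
Let p_gt1 : (1 < pdiv p)%N. Proof. by rewrite pdiv_id // prime_gt1. Qed.
Let p_dvd_q : (pdiv p %| q)%N.
Proof. by rewrite pdiv_id // dvdn_exp. Qed.

Definition rho : {rmorphism R -> 'F_p} := reduction p_gt1 q_gt1 p_dvd_q.

Lemma rho_surj a : exists x, rho x = a.
Proof. by exists (a : nat)%:R; rewrite rmorph_nat /= natr_Zp. Qed.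

Lemma rho_unit x : rho x != 0 -> x \is a GRing.unit.
Proof.
rewrite -[x]natr_Zp rmorph_nat Zp_natr_eq0 // pdiv_id // => px.
by rewrite unitZpE // coprime_sym coprime_pexpr // coprime_sym prime_coprime.
Qed.

(** Some vector that does not vanish modulo [p] belongs to the left kernel. *)
Definition singular m n (W : 'M[R]_(m, n)) : bool :=
  [exists u : 'rV[R]_m, (map_mx rho u != 0) && (u *m W == 0)].

Definition diag_seq m n (s : seq int) : 'M[int]_(m, n) :=
  \matrix_(i, j) (s`_i *+ (i == j :> nat)).

(** The Smith normal form of an integral lift. *)
Lemma Smith_form m n (W : 'M[R]_(m, n)) : exists L D (s : seq int),
  [/\ L \in unitmx, D \in unitmx & W = L *m map_mx intr (diag_seq m n s) *m D].
Proof.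
pose V : 'M[int]_(m, n) := map_mx (fun x : R => (x : nat)%:R) W.
have -> : W = map_mx intr V.
  by apply/matrixP => i j; rewrite !mxE rmorph_nat natr_Zp.
have [L Lu [D Du [s _ ->]]] := int_Smith_normal_form V.
exists (map_mx intr L), (map_mx intr D), s.
by rewrite !map_mxM -/(diag_seq m n s) !unitmx_map.
Qed.

Lemma Smith_nonsingular m n (L : 'M[R]_m) (D : 'M[R]_n) (s : seq int) (i : 'I_m) :
  L \in unitmx -> ~~ singular (L *m map_mx intr (diag_seq m n s) *m D) ->
  ((s`_i)%:~R : R) != 0.
Proof.
move=> Lu; apply: contra => /eqP s0; apply/existsP.
exists (delta_mx 0 i *m invmx L); apply/andP; split.
  apply/negP => /eqP /(congr1 (mulmxr (map_mx rho L))) /=.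
  rewrite -map_mxM mulmxKV // mul0mx => /matrixP /(_ 0 i).
  by rewrite !mxE !eqxx rmorph1 => /eqP; rewrite oner_eq0.
rewrite !mulmxA mulmxKV // -rowE.
suff -> : row i (map_mx intr (diag_seq m n s)) = 0 :> 'rV[R]_n by rewrite mul0mx.
apply/rowP => j; rewrite !mxE rmorphMn /=.
by rewrite s0 mul0rn.
Qed.

(** The last column of the Smith form of a [d * (1 + d)] matrix vanishes. *)
Lemma ker_direction_ex d (W : 'M[R]_(d, 1 + d)) :
  exists2 x : 'cV['F_p]_(1 + d), x != 0 & has_ker rho x W.
Proof.
have [L [D [s [Lu Du ->]]]] := Smith_form W.
pose w : 'cV[R]_(1 + d) := invmx D *m delta_mx ord_max 0.
exists (map_mx rho w).
  apply/negP => /eqP /(congr1 (mulmx (map_mx rho D))).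
  rewrite mulmx0 -map_mxM mulKVmx // => /matrixP /(_ ord_max 0).
  by rewrite !mxE !eqxx rmorph1 => /eqP; rewrite oner_eq0.
apply/existsP; exists w; rewrite eqxx /=; apply/eqP.
rewrite -(mulmxA _ D) mulKVmx // -(mulmxA L) -colE.
suff -> : col ord_max (map_mx intr (diag_seq d (1 + d) s)) = 0 :> 'cV[R]_d by rewrite mulmx0.
apply/colP => i; rewrite !mxE ltn_eqF // mulr0n rmorph0 //.
Qed.

(** If no diagonal entry of the Smith form vanishes modulo [p ^ l], then in
    the coordinates of this form the entries of a kernel vector other than the
    last one are not units. *)
Lemma ker_direction_uniq d (W : 'M[R]_(d, 1 + d)) (x y : 'cV['F_p]_(1 + d)) :
  ~~ singular W -> x != 0 -> has_ker rho x W -> has_ker rho y W ->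
  exists c, y = c *: x.
Proof.
have [L [D [s [Lu Du ->]]]] := Smith_form W => ns.
pose b : 'cV['F_p]_(1 + d) := invmx (map_mx rho D) *m delta_mx ord_max 0.
have Du' : map_mx rho D \in unitmx by exact: unitmx_map.
have line z : has_ker rho z (L *m map_mx intr (diag_seq d (1 + d) s) *m D) ->
    exists c, z = c *: b.
  case/existsP => w /andP[/eqP <- /eqP Ww].
  pose v := D *m w.
  have {}Ww : map_mx intr (diag_seq d (1 + d) s) *m v = 0.
    by rewrite -[LHS](mulKmx Lu) [L *m _](_ : _ = 0) ?mulmx0 // /v !mulmxA.
  have ev : D *m w = v by []; clearbody v.
  have v0 (i : 'I_d) : rho (v (widen_ord (leqnSn d) i) 0) = 0.
    apply: contraNeq (Smith_nonsingular i Lu ns) => /rho_unit vu.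
    move/matrixP: Ww => /(_ i 0); rewrite !mxE (bigD1 (widen_ord (leqnSn d) i)) //=.
    rewrite big1 => [|j ji]; last first.
      rewrite !mxE (_ : (i == j :> nat) = false) ?mulr0n ?rmorph0 ?mul0r //.
      by apply: contraNF ji => /eqP ij; apply/eqP/val_inj.
    rewrite !mxE eqxx mulr1n addr0 => h; apply/eqP.
    by apply: (mulIr vu); rewrite mul0r h.
  exists (rho (v ord_max 0)).
  apply: (can_inj (mulKmx Du')); rewrite -scalemxAr mulKVmx // -map_mxM ev.
  apply/colP => i; rewrite [RHS]mxE [in RHS]mxE [LHS]mxE.
  case: (unliftP ord_max i) => [j ->|->]; last by rewrite !eqxx mulr1.
  rewrite eq_sym (negbTE (neq_lift _ _)) mulr0.
  have -> : lift ord_max j = widen_ord (leqnSn d) j.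
    by apply: val_inj; rewrite /= /bump leqNgt ltn_ord.
  exact: v0.
move=> x0 /line[c ex] /line[e ->]; exists (e / c); rewrite ex scalerA divfK //.
by apply: contraNneq x0 => c0; rewrite ex c0 scale0r.
Qed.

(** The diagonal entries of the Smith form are nonzero modulo [p ^ l], hence
    they divide [p ^ (l - 1)]. *)
Lemma quasi_inverse d (A : 'M[R]_d) : ~~ singular A ->
  exists B : 'M[R]_d, A *m B = (p ^ l.-1)%:R%:M.
Proof.
have [L [D [s [Lu Du ->]]]] := Smith_form A => ns.
have sol (i : 'I_d) : exists y : R, (s`_i)%:~R * y = (p ^ l.-1)%:R.
  have := Smith_nonsingular i Lu ns; rewrite Zp_intr_eq0 // => si.
  have [u [v uv]] := Bezoutz s`_i q%:Z.
  have /(dvdn_pfactor _ _ p_pr)[e el ge] : (`|gcdz s`_i q%:Z| %| p ^ l)%N.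
    by rewrite -[X in (_ %| X)%N]/(`|q%:Z|%N) dvdn_gcdr.
  have {}el : (e <= l.-1)%N.
    rewrite -ltnS prednK // ltn_neqAle el andbT; apply: contraNneq si => el'.
    by rewrite -{1}el' -ge /gcdz absz_nat dvdn_gcdl.
  exists (u * (p ^ (l.-1 - e))%:R)%:~R.
  have qz : (q%:Z%:~R : R) = 0 by apply/eqP; rewrite Zp_intr_eq0.
  rewrite rmorphM /= mulrA -rmorphM /= mulrC.
  have -> : s`_i * u = gcdz s`_i q%:Z - v * q%:Z by rewrite -uv addrK mulrC.
  rewrite rmorphB rmorphM /= qz mulr0 subr0 /gcdz -[gcdn _ _]/`|gcdz s`_i q%:Z|%N ge.
  by rewrite rmorph_nat -natrM -expnD subnK.
have [y hy] := fin_all_exists sol.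
exists (invmx D *m diag_mx (\row_i y i) *m invmx L).
rewrite !mulmxA mulmxK //.
suff -> : L *m map_mx intr (diag_seq d d s) *m diag_mx (\row_i y i) = (p ^ l.-1)%:R *: L.
  by rewrite -scalemxAl mulmxV // scalemx1.
rewrite -mulmxA [X in L *m X](_ : _ = (p ^ l.-1)%:R%:M) ?mul_mx_scalar //.
apply/matrixP => i j; rewrite mul_mx_diag !mxE rmorphMn /=.
rewrite mulrnAl -[in RHS](hy i) -val_eqE /=.
by case: (eqVneq (i : nat) j) => [/val_inj ->|]; rewrite ?mulr1n ?mulr0n.
Qed.

(** A singular matrix is annihilated by a row with an entry equal to [1]. There
    are at most [m * q ^ (m - 1)] such rows, and each of them annihilates a
    fraction [q ^- n] of the matrices. *)
Lemma card_singular m n :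
  (#|@singular m n| * q ^ n * q <= m * q ^ m * q ^ (m * n))%N.
Proof.
have kerE (i : 'I_m) (u : 'rV[R]_m) : u 0 i = 1 ->
    (#|[pred W : 'M[R]_(m, n) | u *m W == 0%R]| * q ^ n = q ^ (m * n))%N.
  move=> ui; have := @card_surj_preim _ _ (mulmx u : 'M[R]_(m, n) -> 'rV[R]_n) (pred1 0).
  rewrite card1 mul1n !card_mx card_Zq // mul1n; apply.
    by move=> V W; rewrite mulmxDr.
  move=> v; exists (delta_mx i 0 *m v); rewrite mulmxA -colE.
  suff -> : col i u = 1%:M by rewrite mul1mx.
  by apply/matrixP => ? ?; rewrite !mxE !ord1 ui.
have oneE (i : 'I_m) : (#|[pred u : 'rV[R]_m | u 0%R i == 1%R]| * q = q ^ m)%N.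
  have := @card_surj_preim _ _ (fun u : 'rV[R]_m => u 0 i) (pred1 1).
  rewrite card1 mul1n !card_mx card_Zq // mul1n; apply.
    by move=> V W; rewrite mxE.
  by move=> c; exists (\row__ c); rewrite mxE.
have cover : (#|@singular m n| <=
    \sum_(i < m) \sum_(u : 'rV[R]_m | u 0%R i == 1%R)
      #|[pred W : 'M[R]_(m, n) | u *m W == 0%R]|)%N.
  under eq_bigr do under eq_bigr do rewrite -sum1_card big_mkcond /=.
  under eq_bigr do rewrite exchange_big /=.
  rewrite exchange_big /= -sum1_card big_mkcond; apply: leq_sum => W _.
  rewrite unfold_in -/(singular W); case: (boolP (singular W)) => //.
  case/existsP => u /andP[u0 /eqP uW].
  have [i ui] : exists i, rho (u 0 i) != 0.
    apply/existsP; apply: contraNT u0; rewrite negb_exists => /forallP h.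
    by apply/eqP/rowP => i; have /negPn/eqP := h i; rewrite !mxE.
  have uU := rho_unit ui.
  rewrite (bigD1 i) //= (bigD1 ((u 0 i)^-1 *: u)) /=; last by rewrite mxE mulVr.
  by rewrite inE -scalemxAl uW scaler0 eqxx.
rewrite -mulnA; apply: leq_trans (leq_mul cover (leqnn _)) _.
rewrite big_distrl /=.
apply: (@leq_trans (\sum_(i < m) q ^ m * q ^ (m * n))%N); last first.
  by rewrite sum_nat_const card_ord mulnA.
apply: leq_sum => i _; apply: eq_leq.
rewrite mulnA big_distrl /= (eq_bigr (fun=> q ^ (m * n))%N) => [|u /eqP /kerE //].
by rewrite sum_nat_const mulnAC oneE.
Qed.

End PrimePower.

(** * Congruences between p-adic integers *)

Lemma natr_ffact (V : comPzRingType) (a k : nat) :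
  (a ^_ k)%:R = \prod_(j < k) (a%:R - j%:R) :> V.
Proof.
elim: k => [|m IH]; first by rewrite ffactn0 big_ord0.
rewrite ffactnSr natrM IH big_ord_recr /=.
have [ma|am] := leqP m a; first by rewrite natrB.
suff -> : \prod_(j < m) (a%:R - j%:R) = 0 :> V by rewrite !mul0r.
by rewrite (bigD1 (Ordinal am)) //= subrr mul0r.
Qed.

Lemma gen_binom_nat (F : fieldType) (a k : nat) : (k`!%:R : F) != 0 ->
  gen_binom (a%:R : F) k = 'C(a, k)%:R.
Proof. by move=> k0; rewrite /gen_binom -natr_ffact -bin_ffact natrM mulfK. Qed.

Section PadicCongruence.
Context (p : nat) (p_pr : prime p).
Local Notation Z_p := (padic_int p_pr).
Local Notation pX e := ((p%:R : Z_p) ^+ e).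
Implicit Types x y : Z_p.

Lemma padic_cong0P e x : cong (pX e) x 0 <-> x e = 0%N.
Proof.
split=> [[w ->]|/padic_valK [y ->]]; last by exists y; rewrite add0r.
by rewrite add0r -natrX padic_mulE padic_natE modnn mul0n mod0n.
Qed.

Lemma cong_subr0 e x y : cong (pX e) x y <-> cong (pX e) (x - y) 0.
Proof.
by split=> -[w h]; exists w; [rewrite h addrC addKr add0r | rewrite -(subrK y x) h; ring].
Qed.

Lemma padic_congP e x y : cong (pX e) x y <-> x e = y e.
Proof.
split=> [[w ->]|xy].
  rewrite padic_addE.
  have -> : (pX e * w) e = 0%N by apply/padic_cong0P; exists w; rewrite add0r.
  by rewrite addn0 padic_res_small.
rewrite cong_subr0 padic_cong0P padic_addE /= modnDmr xy subnKC ?modnn //.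
exact: padic_res_le.
Qed.

Lemma padic_nat_cong e x : cong (pX e) x (x e)%:R.
Proof. by apply/padic_congP; rewrite padic_natE padic_res_small. Qed.

Lemma padic_cong_int e (x y : int) :
  cong ((p%:R : int) ^+ e) x y -> cong (pX e) (x%:~R : Z_p) y%:~R.
Proof. by move/(cong_map (intmul (1 : Z_p))); rewrite rmorphXn /= rmorph_nat. Qed.

Lemma padic_cong_eq x y : (forall e, cong (pX e) x y) -> x = y.
Proof. by move=> h; apply: padic_int_eq => e; apply/padic_congP/h. Qed.

Lemma padic_cong_le e f x y : (e <= f)%N -> cong (pX f) x y -> cong (pX e) x y.
Proof. by move=> /subnKC <-; rewrite exprD; exact: cong_weaken. Qed.

Section Residue.
Context (r : nat) (r_gt0 : (0 < r)%N).

Let q_gt1 : (1 < p ^ r)%N.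
Proof. by rewrite -(exp1n r) ltn_exp2r ?prime_gt1. Qed.

Lemma res_ex : exists f : {rmorphism Z_p -> 'Z_(p ^ r)}, forall x, f x = (x r)%:R.
Proof.
pose f x : 'Z_(p ^ r) := (x r)%:R.
have fD : {morph f : x y / x + y}.
  by move=> x y; rewrite /f padic_addE Zp_nat_mod // natrD.
have fB : zmod_morphism f.
  by move=> x y; apply: (addIr (f y)); rewrite -fD !subrK.
have fM : monoid_morphism f.
  split=> [|x y].
    by have := padic_natE p_pr 1 r; rewrite mulr1n /f => ->; rewrite Zp_nat_mod.
  by rewrite /f padic_mulE Zp_nat_mod // natrM.
pose g : {rmorphism Z_p -> 'Z_(p ^ r)} :=
  HB.pack f (GRing.isZmodMorphism.Build Z_p 'Z_(p ^ r) f fB)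
  (GRing.isMonoidMorphism.Build Z_p 'Z_(p ^ r) f fM).
by exists g.
Qed.

Definition res : {rmorphism Z_p -> 'Z_(p ^ r)} := sval (cid res_ex).

Lemma resE x : res x = (x r)%:R.
Proof. exact: (svalP (cid res_ex)). Qed.

Lemma res_eqP x y : res x = res y <-> cong (pX r) x y.
Proof.
rewrite padic_congP !resE; split=> [/eqP|-> //].
by rewrite Zp_natr_eq // => /eqP; rewrite !padic_res_small.
Qed.

End Residue.

Lemma reduction_res r s (r0 : (0 < r)%N) (s0 : (0 < s)%N) a1 b1 dvd_ab x :
  (r <= s)%N -> @reduction (p ^ r) (p ^ s) a1 b1 dvd_ab (res s0 x) = res r0 x.
Proof.
move=> rs; rewrite !resE rmorph_nat; apply/eqP.
by rewrite Zp_natr_eq // padic_res_mod // padic_res_small.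
Qed.

End PadicCongruence.

(** * Systems of binomial polynomials with p-adic integer coefficients *)

Section System.
Context (p : nat) (p_pr : prime p) (d N n : nat) (N_lt : (N < p ^ n.+1)%N).
Local Notation Z_p := (padic_int p_pr).
Local Notation pX e := ((p%:R : Z_p) ^+ e).
Local Notation K := {ffun 'I_d -> 'I_N.+1}.
Implicit Types (z : 'I_d -> K -> Z_p) (s t u v : 'I_d -> nat).

Let p_gt0 : (0 < p)%N. Proof. exact: prime_gt0. Qed.

Definition sys z i t : Z_p := \sum_k z i k * (bin_prod k t)%:R.

(** The Jacobian matrix of the system, rescaled by [p ^ n]. *)
Definition jac l z t i j : Z_p := \sum_k z i k * (bin_prod_slope p n l k t j)%:R.

Lemma sys_expand l j z i t u : (l <= j)%N ->
  cong (pX (j + l)) (sys z i (fun m => t m + p ^ (n + j) * u m)%N)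
    (sys z i t + pX j * \sum_m (u m)%:R * jac l z t i m).
Proof.
move=> lj.
have -> : sys z i t + pX j * (\sum_m (u m)%:R * jac l z t i m) =
    \sum_k z i k * ((bin_prod k t)%:R +
      pX j * \sum_m (u m)%:R * (bin_prod_slope p n l k t m)%:R).
  under [RHS]eq_bigr do rewrite mulrDr.
  rewrite big_split /=; congr (_ + _).
  rewrite mulr_sumr; under eq_bigr do rewrite /jac !mulr_sumr.
  rewrite exchange_big /=; apply: eq_bigr => k _.
  by rewrite !mulr_sumr; apply: eq_bigr => m _; ring.
apply: cong_sum => k _; apply: congM; first exact: cong_refl.
have := padic_cong_int p_pr (bin_prod_expand p_pr N_lt k t u lj).
rewrite rmorphD rmorphM rmorphXn /= !rmorph_nat rmorph_sum /=.
by under eq_bigr do rewrite rmorphM /= !rmorph_nat.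
Qed.

Let shift m s t : (forall j, s j = t j %[mod p ^ m]) -> exists a u v,
  s = (fun j => a j + p ^ m * u j)%N /\ t = (fun j => a j + p ^ m * v j)%N.
Proof.
move=> st; exists (fun j => s j %% p ^ m)%N, (fun j => s j %/ p ^ m)%N, (fun j => t j %/ p ^ m)%N.
split; apply/funext => j; first by rewrite addnC mulnC -divn_eq.
by rewrite st addnC mulnC -divn_eq.
Qed.

Lemma sys_cong e z i s t : (forall j, s j = t j %[mod p ^ (n + e)]) ->
  cong (pX e) (sys z i s) (sys z i t).
Proof.
case/shift => a [u [v [-> ->]]].
have h w : cong (pX e) (sys z i (fun j => a j + p ^ (n + e) * w j)%N) (sys z i a).
  apply: cong_sum => k _; apply: congM; first exact: cong_refl.
  by have := padic_cong_int p_pr (bin_prod_cong p_pr N_lt e k a w); rewrite !rmorph_nat.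
exact: cong_trans (h u) (cong_sym (h v)).
Qed.

Lemma jac_cong l z i m s t : (forall j, s j = t j %[mod p ^ (n + l)]) ->
  cong (pX l) (jac l z s i m) (jac l z t i m).
Proof.
case/shift => a [u [v [-> ->]]].
have h w : cong (pX l) (jac l z (fun j => a j + p ^ (n + l) * w j)%N i m) (jac l z a i m).
  apply: cong_sum => k _; apply: congM; first exact: cong_refl.
  by have := padic_cong_int p_pr (bin_prod_slope_cong p_pr N_lt l k a w m); rewrite !rmorph_nat.
exact: cong_trans (h u) (cong_sym (h v)).
Qed.

(** The rescaled Jacobian matrix divides [p ^ (l - 1)] modulo [p ^ l]. *)
Definition jac_good l z t : Prop := exists B : 'I_d -> 'I_d -> Z_p,
  forall i j, cong (pX l) (\sum_m jac l z t i m * B m j) (pX l.-1 * (i == j)%:R).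

Lemma jac_good_cong l z s t : (forall j, s j = t j %[mod p ^ (n + l)]) ->
  jac_good l z s -> jac_good l z t.
Proof.
move=> st [B hB]; exists B => i j; apply: cong_trans (hB i j).
apply: cong_sum => m _; apply: congM; last exact: cong_refl.
by apply: jac_cong => k; rewrite st.
Qed.

(** One step of the Newton iteration: the correction is of size
    [p ^ (r - l + 1)] in the rescaled coordinate, so that the quadratic error is
    negligible. *)
Lemma newton_step l r z t : (0 < l)%N -> (l + l <= r)%N -> jac_good l z t ->
  (forall i, cong (pX r) (sys z i t) 0) ->
  exists2 t', forall j, t' j = t j %[mod p ^ (n + l)] &
    forall i, cong (pX r.+1) (sys z i t') 0.
Proof.
move=> l0 lr [B hB] hr.
have ex i : exists w, sys z i t = pX r * w.
  by have [w ->] := hr i; exists w; rewrite add0r.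
have [y hy] := choice ex.
pose j := (r - l).+1.
have lj : (l <= j)%N by rewrite /j; lia.
(* [jac * w] is [- p ^ (l - 1) * y] modulo [p ^ l], that is, [p ^ j * w] cancels
   the value [p ^ r * y] modulo [p ^ r.+1] *)
pose w i := - \sum_m B i m * y m.
pose u i := w i l.
exists (fun i => t i + p ^ (n + j) * u i)%N.
  move=> i; have -> : (n + j = n + l + (j - l))%N by lia.
  by rewrite expnD -mulnA [(p ^ (n + l) * _)%N]mulnC addnC modnMDl.
have ejl : (j + l = r.+1)%N by rewrite /j; lia.
move=> i; rewrite -ejl; apply: cong_trans (sys_expand z i t u lj) _.
rewrite hy exprD.
have -> : pX r = pX j * pX l.-1 by rewrite -exprD; congr (_ ^+ _); lia.
rewrite -[X in cong _ _ X](mulr0 (pX j)) -mulrA -mulrDr; apply: cong_scale.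
have h1 : cong (pX l) (\sum_m (u m)%:R * jac l z t i m) (- (pX l.-1 * y i)).
  apply: (@cong_trans _ _ (\sum_m w m * jac l z t i m)).
    apply: cong_sum => m _; apply: congM; last exact: cong_refl.
    exact: cong_sym (padic_nat_cong _ _).
  have -> : \sum_m w m * jac l z t i m = - \sum_k (\sum_m jac l z t i m * B m k) * y k.
    under eq_bigr do rewrite /w mulNr mulr_suml.
    rewrite sumrN; congr (- _); rewrite exchange_big /=; apply: eq_bigr => k _.
    by rewrite mulr_suml; apply: eq_bigr => m _; ring.
  have -> : - (pX l.-1 * y i) = - \sum_k (pX l.-1 * (i == k)%:R) * y k.
    rewrite (bigD1 i) //= eqxx mulr1 big1 ?addr0 // => k ki.
    by rewrite eq_sym (negbTE ki) mulr0 mul0r.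
  rewrite -![- \sum_k _]mulN1r; apply: congM; first exact: cong_refl.
  by apply: cong_sum => k _; apply: congM; [exact: hB | exact: cong_refl].
by have := congD (cong_refl (pX l) (pX l.-1 * y i)) h1; rewrite addrN.
Qed.

(** The Jacobian matrix does not change modulo [p ^ l] during the iteration, so
    that it remains good. *)
Lemma newton l z t : (0 < l)%N -> jac_good l z t ->
  (forall i, cong (pX (l + l)) (sys z i t) 0) ->
  forall r, exists2 t', forall j, t' j = t j %[mod p ^ (n + l)] &
    forall i, cong (pX r) (sys z i t') 0.
Proof.
move=> l0 good h0 r; have [rl|/ltnW lr] := leqP r (l + l).
  by exists t => // i; apply: padic_cong_le rl (h0 i).
rewrite -(subnKC lr); elim: (r - (l + l))%N => [|k [s st hs]].
  by exists t => // i; rewrite addn0.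
have goods : jac_good l z s by apply: jac_good_cong good => j; rewrite st.
have [t' t's ht'] := newton_step l0 (leq_addr k _) goods hs.
by exists t' => [j|i]; [rewrite t's st | rewrite addnS].
Qed.

(** The values of the binomial functions at a point of [Z_p], by continuity. *)
Lemma padic_bin_coh (t : Z_p) (k : 'I_N.+1) e :
  'C(t (n + e.+1), k) = 'C(t (n + e), k) %[mod p ^ e].
Proof.
have kN : (k < p ^ n.+1)%N by exact: leq_ltn_trans (leq_ord k) N_lt.
have := bin_cong p_pr e (t (n + e)) (t (n + e.+1) %/ p ^ (n + e)) kN.
rewrite [(_ + p ^ _ * _)%N](_ : _ = t (n + e.+1)); last first.
  rewrite [RHS](divn_eq _ (p ^ (n + e))) addnC mulnC; congr (_ + _)%N.
  by rewrite padic_res_mod // leq_add2l.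
move/(padic_cong_int p_pr); rewrite !rmorph_nat => /padic_congP.
by rewrite !padic_natE.
Qed.

Definition padic_bin (t : Z_p) (k : 'I_N.+1) : Z_p := mk_padic_int p_pr (padic_bin_coh t k).

Lemma padic_bin_cong e (t : Z_p) (k : 'I_N.+1) :
  cong (pX e) (padic_bin t k) ('C(t (n + e), k))%:R.
Proof. by apply/padic_congP; rewrite padic_natE. Qed.

(** Both sides are continuous in [t] and agree on natural numbers. *)
Lemma fact_padic_bin (t : Z_p) (k : 'I_N.+1) :
  (k`!)%:R * padic_bin t k = \prod_(j < k) (t - j%:R).
Proof.
apply: padic_cong_eq => e.
apply: cong_trans (congM (cong_refl _ _) (padic_bin_cong e t k)) _.
rewrite -natrM mulnC bin_ffact.
rewrite natr_ffact.
apply: cong_prod => j _; apply: congD; last exact: cong_refl.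
by apply: padic_cong_le (leq_addl n e) (cong_sym (padic_nat_cong _ _)).
Qed.

Local Notation tofrac := (@FracField.tofrac Z_p).

Lemma padic_natr_neq0 m : (0 < m)%N -> (m%:R : Z_p) != 0.
Proof.
move=> m0; apply/eqP => /(congr1 (fun x : Z_p => x m)).
have m_lt : (m < p ^ m)%N by rewrite ltn_expl // prime_gt1.
by rewrite padic_natE padic_zeroE (modn_small m_lt) => e; rewrite e in m0.
Qed.

Lemma gen_binomE (t : Z_p) (k : 'I_N.+1) :
  gen_binom (tofrac t : padic p_pr) k = tofrac (padic_bin t k).
Proof.
have k0 : (tofrac (k`!)%:R : padic p_pr) != 0.
  by rewrite tofrac_eq0 padic_natr_neq0 // fact_gt0.
apply: (mulfI k0); rewrite -tofracM fact_padic_bin /gen_binom.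
rewrite rmorph_nat mulrC divfK; last by rewrite -(rmorph_nat tofrac).
by rewrite rmorph_prod; apply: eq_bigr => j _; rewrite rmorphB rmorph_nat.
Qed.

Lemma binom_poly_nat (z : K -> padic p_pr) t :
  binom_poly z (\row_j (t j)%:R) = \sum_k z k * (bin_prod k t)%:R.
Proof.
apply: eq_bigr => k _; congr (_ * _); rewrite natr_prod; apply: eq_bigr => j _.
rewrite mxE gen_binom_nat // -(rmorph_nat tofrac) tofrac_eq0.
by rewrite padic_natr_neq0 // fact_gt0.
Qed.

Definition padic_sys z i (t : 'I_d -> Z_p) : Z_p :=
  \sum_k z i k * \prod_j padic_bin (t j) (k j).

Lemma binom_polyE (z : 'I_d -> K -> Z_p) i (t : 'I_d -> Z_p) :
  binom_poly (fun k => tofrac (z i k) : padic p_pr) (\row_j tofrac (t j)) =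
  tofrac (padic_sys z i t).
Proof.
rewrite rmorph_sum; apply: eq_bigr => k _; rewrite rmorphM rmorph_prod.
by congr (_ * _); apply: eq_bigr => j _; rewrite mxE gen_binomE.
Qed.

Lemma padic_sys_cong e z i (t : 'I_d -> Z_p) :
  cong (pX e) (padic_sys z i t) (sys z i (fun j => t j (n + e)%N)).
Proof.
apply: cong_sum => k _; apply: congM; first exact: cong_refl.
rewrite /bin_prod natr_prod; apply: cong_prod => j _; exact: padic_bin_cong.
Qed.

Definition zero_in z m (c : 'I_d -> nat) : Prop :=
  exists t : 'I_d -> Z_p, (forall j, t j m = c j %[mod p ^ m]) /\
    forall i, padic_sys z i t = 0.

Definition near_zero_in z m (c : 'I_d -> nat) r : Prop :=
  exists a : 'I_d -> nat, (forall j, a j = c j %[mod p ^ m]) /\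
    forall i, cong (pX r) (sys z i a) 0.

Lemma zero_in_near z m c r : zero_in z m c -> near_zero_in z m c r.
Proof.
case=> t [tc t0]; exists (fun j => t j (n + (r + m))%N); split.
  move=> j; rewrite -tc padic_res_mod ?padic_res_small //.
  by rewrite addnA leq_addl.
move=> i; rewrite -(t0 i); apply: cong_sym.
exact: padic_cong_le (leq_addr m r) (padic_sys_cong (r + m) z i t).
Qed.

Lemma near_zero_le z m c r r' : (r <= r')%N ->
  near_zero_in z m c r' -> near_zero_in z m c r.
Proof.
move=> rr' [a [ac a0]]; exists a; split=> // i.
exact: padic_cong_le rr' (a0 i).
Qed.

(** A box that contains approximate zeros of every precision has a sub-box with
    the same property, by the pigeonhole principle. *)
Lemma near_zero_refine z m c : (forall r, near_zero_in z m c r) ->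
  exists c', (forall j, c' j = c j %[mod p ^ m]) /\
    forall r, near_zero_in z m.+1 c' r.
Proof.
move=> h; apply: contrapT => no.
pose sub (D : {ffun 'I_d -> 'I_p}) j := (c j %% p ^ m + p ^ m * D j)%N.
have ex D : exists b, ~ near_zero_in z m.+1 (sub D) b.
  apply/existsNP => hD; apply: no; exists (sub D); split=> // j.
  by rewrite /sub mulnC addnC modnMDl modn_mod.
have [b hb] := choice ex.
have [a [ac a0]] := h (\max_D b D)%N.
pose D := [ffun j => Ordinal (ltn_pmod (a j %/ p ^ m) p_gt0)].
apply: (hb D); apply: (near_zero_le (leq_bigmax D)); exists a; split=> // j.
rewrite /sub ffunE /= -ac {1}(divn_eq (a j) (p ^ m)).
rewrite {1}(divn_eq (a j %/ p ^ m) p) mulnDl -mulnA -expnS -addnA modnMDl.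
by rewrite mulnC addnC.
Qed.

(** Compactness of [Z_p ^ d]: the nested boxes given by [near_zero_refine] shrink
    to a zero. *)
Lemma zero_inP z m c : zero_in z m c <-> forall r, near_zero_in z m c r.
Proof.
split=> [h r|h]; first exact: zero_in_near.
pose T := {a : nat * ('I_d -> nat) | forall r, near_zero_in z a.1 a.2 r}.
pose next (a b : T) := (sval b).1 = (sval a).1.+1 /\
  forall j, (sval b).2 j = (sval a).2 j %[mod p ^ (sval a).1].
have ex a : exists b, next a b.
  case: a => -[m' c'] h'; have [c'' [c''c h'']] := near_zero_refine h'.
  by exists (exist _ (m'.+1, c'') h'').
have [f hf] := choice ex.
pose a k := iter k f (exist _ (m, c) h : T).
have a1 k : (sval (a k)).1 = (m + k)%N.
  by elim: k => [|k IH]; rewrite ?addn0 //= (hf (a k)).1 IH addnS.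
have a2 k k' j : (sval (a (k + k')%N)).2 j = (sval (a k)).2 j %[mod p ^ (m + k)].
  elim: k' => [|k' IH]; first by rewrite addn0.
  rewrite -IH addnS /=; have := (hf (a (k + k')%N)).2 j; rewrite a1.
  move=> /(congr1 (modn^~ (p ^ (m + k))%N)).
  by rewrite !modn_dvdm // dvdn_exp2l // addnA leq_addr.
have coh j k : (sval (a k.+1)).2 j = (sval (a k)).2 j %[mod p ^ k].
  have := a2 k 1%N j; rewrite addn1 => /(congr1 (modn^~ (p ^ k)%N)).
  by rewrite !modn_dvdm // dvdn_exp2l // leq_addl.
pose t j : Z_p := mk_padic_int p_pr (coh j).
exists t; split=> [j|i].
  by have := a2 0%N m j; rewrite add0n addn0 /= modn_mod.
apply: padic_cong_eq => e; apply: cong_trans (padic_sys_cong e z i t) _.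
have [b [bc b0]] := svalP (a (n + e)%N) e.
apply: cong_trans (b0 i); apply: sys_cong => j /=.
have := bc j; rewrite a1 => /(congr1 (modn^~ (p ^ (n + e))%N)).
by rewrite !modn_dvdm ?dvdn_exp2l ?leq_addl // => ->; rewrite modn_mod.
Qed.

(** With [j = l] the error of the first order expansion is a multiple of
    [p ^ (2 * l)]. *)
Lemma zero_in_linear l z c : zero_in z (n + l) c ->
  (forall j, c j < p ^ (n + l))%N ->
  exists v : 'I_d -> nat, forall i,
    cong (pX (l + l)) (sys z i c + pX l * \sum_m (v m)%:R * jac l z c i m) 0.
Proof.
move=> /zero_in_near - /(_ (l + l)%N) [a [ac a0]] c_lt.
exists (fun j => a j %/ p ^ (n + l))%N => i; apply: cong_trans (a0 i).
apply: cong_sym; have := sys_expand z i c (fun j => a j %/ p ^ (n + l))%N (leqnn l).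
congr cong; congr sys; apply/funext => j.
by rewrite addnC mulnC [RHS](divn_eq _ (p ^ (n + l))) ac modn_small.
Qed.

Lemma linear_zero_in l z c : (0 < l)%N -> jac_good l z c ->
  (exists v : 'I_d -> nat, forall i,
    cong (pX (l + l)) (sys z i c + pX l * \sum_m (v m)%:R * jac l z c i m) 0) ->
  zero_in z (n + l) c.
Proof.
move=> l0 good [v hv]; apply/zero_inP => r.
pose t j := (c j + p ^ (n + l) * v j)%N.
have tc j : t j = c j %[mod p ^ (n + l)] by rewrite /t addnC mulnC modnMDl.
have [||t' t't ht'] := @newton l z t l0 _ _ r.
- by apply: jac_good_cong good => j; rewrite tc.
- by move=> i; apply: cong_trans (hv i); exact: sys_expand.
- by exists t'; split=> // j; rewrite t't tc.
Qed.

End System.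

(** * The first order jet of a random system *)

Section FiniteModel.
Context (p : nat) (p_pr : prime p) (d N n : nat) (N_lt : (N < p ^ n.+1)%N).
Context (pn_le : (p ^ n <= N)%N) (l : nat) (l_gt0 : (0 < l)%N).
Local Notation Z_p := (padic_int p_pr).
Local Notation K := {ffun 'I_d -> 'I_N.+1}.
Local Notation q := (p ^ l)%N.
Local Notation q2 := (p ^ (l + l))%N.
Local Notation Data := {ffun 'I_d * K -> 'Z_q2}.
Local Notation Jet := ('cV['Z_q2]_d * 'M['Z_q]_d)%type.

Let p_gt0 : (0 < p)%N. Proof. exact: prime_gt0. Qed.
Let pX_gt0 e : (0 < p ^ e)%N. Proof. by rewrite expn_gt0 p_gt0. Qed.
Let ll_gt0 : (0 < l + l)%N. Proof. by rewrite addn_gt0 l_gt0. Qed.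
Let q_gt1 : (1 < q)%N.
Proof. by rewrite -(exp1n l) ltn_exp2r ?prime_gt1. Qed.
Let q2_gt1 : (1 < q2)%N.
Proof. by rewrite -(exp1n (l + l)) ltn_exp2r ?prime_gt1. Qed.
Let q_dvd : (q %| q2)%N. Proof. by rewrite dvdn_exp2l // leq_addr. Qed.
Let q2E : q2 = (q * q)%N. Proof. by rewrite expnD. Qed.

Let red := reduction q_gt1 q2_gt1 q_dvd.
Let rho := rho p_pr l_gt0.

(** The first order jet at [c] of the system with coefficients [x]: its value
    modulo [p ^ (2 * l)] and its rescaled Jacobian matrix modulo [p ^ l]. *)
Definition jet (c : 'I_d -> nat) (x : Data) : Jet :=
  (\col_i \sum_k x (i, k) * (bin_prod k c)%:R,
   \matrix_(i, j) \sum_k red (x (i, k)) * (bin_prod_slope p n l k c j)%:R).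

Lemma jetD c : {morph jet c : x y / x + y}.
Proof.
move=> x y; congr (_, _); apply/matrixP => i j; rewrite !mxE -big_split /=.
  by apply: eq_bigr => k _; rewrite ffunE mulrDl.
by apply: eq_bigr => k _; rewrite ffunE rmorphD mulrDl.
Qed.

(** The coefficients of index [0] prescribe the values, and those of index
    [p ^ n] times a basis vector prescribe the Jacobian matrix. *)
Lemma jet_surj c y : exists x, jet c x = y.
Proof.
case: y => F A.
pose k0 : K := [ffun => ord0].
pose kk j : K := [ffun m => if m == j then inord (p ^ n) else ord0].
have kkE j : kk j j = (p ^ n)%N :> nat by rewrite ffunE eqxx inordK // ltnS.
have kk0 j m : m != j -> kk j m = 0%N :> nat by rewrite ffunE => /negbTE ->.
pose b j := bin_slope p n l (p ^ n) (c j).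
have bU j : (b j)%:R \is a @GRing.unit 'Z_q.
  by rewrite unitZpE // coprime_pexpl // prime_coprime // bin_slope_pX.
pose y i j : 'Z_q2 := (A i j / (b j)%:R : nat)%:R.
have redy i j : red (y i j) = A i j / (b j)%:R by rewrite rmorph_nat natr_Zp.
pose a i := F i 0 - \sum_j y i j * (bin_prod (kk j) c)%:R.
have sumE (V : comPzRingType) (g : K -> V) k' (v : V) :
    \sum_k (v *+ (k == k')) * g k = v * g k'.
  rewrite (bigD1 k') //= eqxx big1 ?addr0 // => k /negbTE ->.
  by rewrite mulr0n mul0r.
have phi0 : bin_prod k0 c = 1%N.
  by rewrite /bin_prod big1 // => j _; rewrite ffunE bin0.
have slope0 m : bin_prod_slope p n l k0 c m = 0%N.
  by rewrite /bin_prod_slope ffunE bin_slope0.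
have slope_diag j : bin_prod_slope p n l (kk j) c j = b j.
  by rewrite /bin_prod_slope kkE big1 ?muln1 // => m /kk0 ->; rewrite bin0.
have slope_off j m : m != j -> bin_prod_slope p n l (kk j) c m = 0%N.
  by move=> /kk0 mj; rewrite /bin_prod_slope mj bin_slope0.
exists [ffun ik => a ik.1 *+ (ik.2 == k0) + \sum_j y ik.1 j *+ (ik.2 == kk j)].
congr (_, _); apply/matrixP => i j; rewrite !mxE.
  under eq_bigr do rewrite ffunE /= mulrDl mulr_suml.
  rewrite big_split /= sumE phi0 mulr1 exchange_big /=.
  under [X in _ + X]eq_bigr do rewrite sumE.
  by rewrite /a subrK ord1.
under eq_bigr do rewrite ffunE /= rmorphD rmorphMn rmorph_sum mulrDl mulr_suml /=.
rewrite big_split /= sumE slope0 mulr0 add0r exchange_big /=.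
rewrite (bigD1 j) //= [X in _ + X]big1 ?addr0 => [|m mj].
  under eq_bigr do rewrite rmorphMn /=.
  by rewrite sumE slope_diag redy divrK.
under eq_bigr do rewrite rmorphMn /=.
by rewrite sumE slope_off 1?eq_sym // mulr0.
Qed.

Lemma card_jet_preim c (S : {pred Jet}) :
  (#|[pred x | jet c x \in S]| * (q2 ^ d * q ^ (d * d)) = #|S| * #|{: Data}|)%N.
Proof.
have := card_surj_preim S (@jetD c) (@jet_surj c).
by rewrite card_prod !card_mx !card_Zq // muln1.
Qed.

(** Multiplication by [q], as an injection of the integers modulo [q] into the
    integers modulo [q ^ 2]. *)
Definition scale_q (x : 'Z_q) : 'Z_q2 := (q * x)%:R.

Lemma scale_q_inj : injective scale_q.
Proof.
move=> x y /eqP; rewrite Zp_natr_eq // q2E -!muln_modr eqn_pmul2l //.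
have lt_q (z : 'Z_q) : (z < q)%N by rewrite -{2}(Zp_cast q_gt1).
by rewrite !modn_small // => /eqP /val_inj.
Qed.

Lemma scale_q_res (x : Z_p) :
  scale_q (res p_pr l_gt0 x) = res p_pr ll_gt0 (p%:R ^+ l * x).
Proof.
rewrite /scale_q resE val_Zp_nat // padic_res_small.
rewrite -(rmorph_nat (res p_pr ll_gt0)); apply/res_eqP.
rewrite natrM natrX exprD; apply: cong_scale; apply: cong_sym.
exact: padic_nat_cong.
Qed.

(** The jets for which the linearized system is solvable modulo
    [p ^ (2 * l)]. The value of such a jet is divisible by [p ^ l]. *)
Definition solvable : {pred Jet} :=
  [pred y | [exists W, affine_ker rho W &&
     ((map_mx scale_q (lsubmx W) == y.1) && (rsubmx W == y.2))]].

(** The value of a solvable jet is [q * U] for a unique [U] modulo [q]. *)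
Lemma card_solvable : #|solvable| = #|@affine_ker _ _ rho d|.
Proof.
pose h (W : 'M['Z_q]_(d, 1 + d)) : Jet := (map_mx scale_q (lsubmx W), rsubmx W).
have h_inj : injective h.
  move=> V W [/matrixP eU eA]; rewrite -(hsubmxK V) -(hsubmxK W) eA.
  by congr row_mx; apply/matrixP => i j; have := eU i j; rewrite !mxE => /scale_q_inj.
rewrite -(fintype.card_image h_inj); apply: eq_card => y.
apply/existsP/fintype.imageP => [[W /and3P[hW /eqP e1 /eqP e2]]|[W hW ->]].
  by exists W => //; case: y e1 e2 => ? ? /= <- <-.
by exists W; rewrite !eqxx !andbT.
Qed.

Lemma card_solvable_singular :
  (#|[pred y in solvable | singular p_pr l_gt0 y.2]|
    <= q ^ d * #|@singular _ p_pr _ l_gt0 d d|)%N.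
Proof.
pose h (x : 'cV['Z_q]_d * 'M['Z_q]_d) : Jet := (map_mx scale_q x.1, x.2).
have -> : (q ^ d = #|{: 'cV['Z_q]_d}|)%N by rewrite card_mx card_Zq // muln1.
rewrite -cardX; apply: leq_trans (leq_image_card h _).
apply: fintype.subset_leq_card; apply/fintype.subsetP => y.
rewrite inE => /andP[/existsP[W /and3P[_ /eqP e1 /eqP e2]] sy].
apply/fintype.imageP; exists (lsubmx W, rsubmx W); first by rewrite inE /= e2.
by case: y e1 e2 sy => ? ? /= <- <-.
Qed.

Section Link.
Context (z : 'I_d -> K -> Z_p) (c : 'I_d -> nat).

Let A : 'M['Z_q]_d := \matrix_(i, j) res p_pr l_gt0 (jac n l z c i j).

Definition coef_res : Data := [ffun ik => res p_pr ll_gt0 (z ik.1 ik.2)].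

Lemma jet_coef_res : jet c coef_res =
  (\col_i res p_pr ll_gt0 (sys z i c), A).
Proof.
congr (_, _); apply/matrixP => i j; rewrite !mxE rmorph_sum; apply: eq_bigr => k _.
  by rewrite ffunE rmorphM rmorph_nat.
by rewrite ffunE [RHS]rmorphM rmorph_nat reduction_res // leq_addr.
Qed.

Lemma zero_in_solvable : (forall j, c j < p ^ (n + l))%N ->
  zero_in N_lt z (n + l) c -> jet c coef_res \in solvable.
Proof.
move=> c_lt /zero_in_linear - /(_ c_lt) [v hv].
rewrite jet_coef_res.
pose V : 'cV['Z_q]_d := \col_j (v j)%:R.
apply/existsP; exists (row_mx (- (A *m V)) A).
rewrite row_mxKl row_mxKr eqxx andbT; apply/andP; split.
  apply/existsP; exists (map_mx rho V); apply/existsP; exists (col_mx 1 V).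
  by rewrite map_col_mx map_mx1 eqxx mul_row_col mulmx1 addNr eqxx.
apply/eqP/matrixP => i j; rewrite !mxE.
have -> : - \sum_m A i m * V m j =
    res p_pr l_gt0 (- \sum_m (v m)%:R * jac n l z c i m).
  rewrite rmorphN rmorph_sum; congr (- _); apply: eq_bigr => m _.
  by rewrite !mxE rmorphM rmorph_nat mulrC.
rewrite scale_q_res; apply/res_eqP; apply: cong_sym.
have := congD (hv i) (cong_refl _ (- (p%:R ^+ l * \sum_m (v m)%:R * jac n l z c i m))).
by rewrite addrK add0r mulrN.
Qed.

Lemma solvable_zero_in : jet c coef_res \in solvable ->
  ~~ singular p_pr l_gt0 (jet c coef_res).2 -> zero_in N_lt z (n + l) c.
Proof.
rewrite jet_coef_res => /existsP[W /and3P[hW /eqP eF /eqP eA]] ns.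
apply: linear_zero_in => //.
  have [B eB] := quasi_inverse ns.
  exists (fun i j => (B i j : nat)%:R) => i j; apply/(res_eqP l_gt0).
  move/matrixP: eB => /(_ i j); rewrite !mxE => eB.
  rewrite rmorph_sum rmorphM rmorphXn /= !rmorph_nat -natrX mulr_natr -eB.
  by apply: eq_bigr => m _; rewrite !mxE rmorphM rmorph_nat natr_Zp.
case/existsP: hW => y /existsP[w /andP[/eqP wy /eqP Ww]].
have w0U : w (lshift d 0) 0 \is a GRing.unit.
  apply: (@rho_unit p p_pr l l_gt0); move/matrixP: wy => /(_ (lshift d 0) 0).
  by rewrite mxE col_mxEu mxE eqxx => ->; exact: oner_neq0.
have [V VE] : exists V : 'I_d -> 'Z_q, forall j, V j = w (rshift 1 j) 0 / w (lshift d 0) 0.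
  by exists (fun j => w (rshift 1 j) 0 / w (lshift d 0) 0).
exists (fun j => (V j : nat)) => i.
have : res p_pr ll_gt0 (sys z i c) = scale_q (W i (lshift d 0)).
  by move/matrixP: eF => /(_ i 0); rewrite !mxE.
have -> : W i (lshift d 0) =
    res p_pr l_gt0 (- \sum_m (V m : nat)%:R * jac n l z c i m).
  move/matrixP: Ww => /(_ i 0); rewrite !mxE big_split_ord /= big_ord1 => e.
  apply: (mulIr w0U); apply: (addIr (\sum_(m < d) W i (rshift 1 m) * w (rshift 1 m) 0)).
  rewrite e rmorphN rmorph_sum mulNr mulr_suml addrC; apply/esym/eqP; rewrite subr_eq0.
  apply/eqP; apply: eq_bigr => m _.
  rewrite (rmorphM (res p_pr l_gt0)) rmorph_nat natr_Zp VE mulrAC divrK // mulrC.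
  congr (_ * _).
  by move/matrixP: eA => /(_ i m); rewrite !mxE.
rewrite scale_q_res => /res_eqP h.
have := congD h (cong_refl _ (p%:R ^+ l * \sum_m (V m : nat)%:R * jac n l z c i m)).
by rewrite mulrN addNr.
Qed.

End Link.

End FiniteModel.

(** * The limit of the probability of solvability *)

Section Estimates.
Context (R : realFieldType) (p : nat) (p_pr : prime p) (d : nat).
Local Notation L := ((\sum_(j < d.+1) p%:R ^- j)^-1 : R).

Let p_gt1 : (1 < p)%N. Proof. exact: prime_gt1. Qed.
Let p_gt0 : (0 < p)%N. Proof. exact: prime_gt0. Qed.

(** The number of points of the affine chart divided by the number of points of
    the projective space over ['F_p]. *)
Lemma affine_fraction : L * (p%:R ^+ d.+1 - 1) = p%:R ^+ d * (p%:R - 1).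
Proof.
have p0 : (p%:R : R) != 0 by rewrite pnatr_eq0 -lt0n.
have e : p%:R ^+ d * \sum_(j < d.+1) p%:R ^- j = \sum_(j < d.+1) p%:R ^+ j :> R.
  rewrite mulr_sumr (reindex_inj rev_ord_inj) /=; apply: eq_bigr => j _.
  rewrite subSS; have jd : (j <= d)%N by rewrite -ltnS.
  by rewrite -{1}(subnKC jd) exprD mulfK // expf_neq0.
have S0 : \sum_(j < d.+1) p%:R ^- j != 0 :> R.
  apply: lt0r_neq0; rewrite big_ord_recl expr0 invr1.
  by rewrite ltr_wpDr // sumr_ge0 // => j _; rewrite invr_ge0 exprn_ge0.
by rewrite subrX1 -e; field.
Qed.

Context (l : nat) (l_gt0 : (0 < l)%N).
Local Notation q := (p ^ l)%N.

Let q_gt1 : (1 < q)%N.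
Proof. by rewrite -(exp1n l) ltn_exp2r. Qed.
Let q_gt0 : (0 < q)%N. Proof. exact: ltnW. Qed.
Let qX_gt0 m : (0 < q ^ m)%N. Proof. by rewrite expn_gt0 q_gt0. Qed.
Let qR_gt0 : 0 < (q%:R : R). Proof. by rewrite ltr0n. Qed.

Definition solvable_prob : R :=
  #|@affine_ker _ _ (rho p_pr l_gt0) d|%:R / q%:R ^+ (d * (1 + d)).

Definition singular_prob : R :=
  #|@singular _ p_pr _ l_gt0 d d|%:R / q%:R ^+ (d * d).

Lemma singular_prob_le : singular_prob <= d%:R / q%:R.
Proof.
have := card_singular p_pr l_gt0 d d.
rewrite mulnAC [(d * q ^ d * _)%N]mulnAC (leq_pmul2r (qX_gt0 d)) => h.
rewrite /singular_prob ler_pdivrMr ?exprn_gt0 // mulrAC ler_pdivlMr //.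
by rewrite -natrX -!natrM ler_nat.
Qed.

(** The double countings hold up to the number of singular matrices, which is
    negligible. *)
Lemma solvable_prob_near :
  `|solvable_prob - L| <= p%:R ^+ (2 * d).+1 * d%:R / q%:R.
Proof.
pose kappa := #|has_ker (rho p_pr l_gt0) (delta_mx 0 0 : 'cV['F_p]_(1 + d))|.
pose b := #|@singular _ p_pr _ l_gt0 d (1 + d)|.
pose M := (q ^ (d * (1 + d)))%N.
have cardM : #|{: 'M['Z_q]_(d, 1 + d)}| = M by rewrite card_mx card_Zq.
have hs := @rho_surj p p_pr l l_gt0.
have hu := @rho_unit p p_pr l l_gt0.
have hex := @ker_direction_ex p p_pr l l_gt0 d.
have huniq := @ker_direction_uniq p p_pr l l_gt0 d.
have H1 := card_has_ker_lower hs hu hex.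
have H2 := card_has_ker_upper hs hu hex huniq.
have H3 := card_affine_ker_le hs hu d.
have H4 := card_affine_ker_ge hs hu huniq.
rewrite -/kappa -/b cardM card_Fp // in H1 H2 H3 H4.
have Hb : (b * q <= d * M)%N.
  have := card_singular p_pr l_gt0 d (1 + d); rewrite -/b -/M.
  rewrite [(q ^ (1 + d))%N]expnS [(b * _)%N]mulnA mulnAC [(d * q ^ d * M)%N]mulnAC.
  rewrite (leq_pmul2r (qX_gt0 d)); apply: leq_trans.
  by rewrite leq_pmulr.
have M0 : 0 < (M%:R : R) by rewrite ltr0n qX_gt0.
rewrite /solvable_prob -natrX -/M; set a := #|_| in H3 H4 *.
have pd1 : (0 < p ^ d.+1)%N by rewrite expn_gt0 p_gt0.
have {}H1 : (p%:R - 1) * M%:R <= (p%:R ^+ d.+1 - 1) * kappa%:R :> R.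
  by move: H1; rewrite -(ler_nat R) !natrM -!subn1 !natrB // natrX.
have {}H2 : (p%:R ^+ d.+1 - 1) * kappa%:R <= (p%:R - 1) * M%:R + p%:R ^+ d.+1 * b%:R :> R.
  by move: H2; rewrite -(ler_nat R) natrD !natrM -!subn1 !natrB // natrX.
have {}H3 : a%:R <= p%:R ^+ d * kappa%:R :> R.
  by move: H3; rewrite -(ler_nat R) natrM natrX.
have {}H4 : p%:R ^+ d * kappa%:R <= a%:R + p%:R ^+ d * b%:R :> R.
  by move: H4; rewrite -(ler_nat R) natrD !natrM natrX.
have {}Hb : b%:R * q%:R <= d%:R * M%:R :> R by rewrite -!natrM ler_nat.
have P1 : 1 <= p%:R ^+ d :> R by rewrite exprn_ege1 // ler1n.
have PS : p%:R ^+ d.+1 = p%:R * p%:R ^+ d :> R by rewrite exprS.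
have p2 : 2 <= p%:R :> R by rewrite ler_nat.
have T1 : 1 <= p%:R ^+ d.+1 - 1 :> R.
  rewrite PS lerBrDr; apply: le_trans (_ : p%:R * 1 <= _); first by rewrite mulr1.
  by rewrite ler_wpM2l.
have b0 : 0 <= b%:R :> R by [].
have LE := affine_fraction.
have P2 : p%:R ^+ (2 * d).+1 = p%:R ^+ d * p%:R ^+ d.+1 :> R by rewrite -exprD; congr (_ ^+ _); lia.
move: (p%:R ^+ d) (p%:R ^+ d.+1) (p%:R ^+ (2 * d).+1) (L) H1 H2 H3 H4 P1 PS T1 LE P2.
move=> X Y W l0 H1 H2 H3 H4 P1 PS T1 LE P2.
have T0 : 0 < Y - 1 by lra.
have upper : a%:R <= l0 * M%:R + W * b%:R.
  rewrite -(ler_pM2r T0) mulrDl mulrAC LE.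
  apply: le_trans (ler_wpM2r (ltW T0) H3) _; rewrite P2.
  have : X * ((Y - 1) * kappa%:R) <= X * ((p%:R - 1) * M%:R + Y * b%:R).
    by apply: ler_wpM2l H2; lra.
  have : 0 <= X * Y * b%:R * (Y - 1 - 1).
    by rewrite !mulr_ge0 //; lra.
  move: (kappa%:R) (b%:R) (M%:R) (p%:R) => k b' M' p'; nra.
have lower : l0 * M%:R - W * b%:R <= a%:R.
  have h : l0 * M%:R - X * b%:R <= a%:R.
    rewrite -(ler_pM2r T0) mulrBl mulrAC LE.
    have : X * ((p%:R - 1) * M%:R) <= X * ((Y - 1) * kappa%:R).
      by apply: ler_wpM2l H1; lra.
    have : (X * kappa%:R) * (Y - 1) <= (a%:R + X * b%:R) * (Y - 1).
      by apply: ler_wpM2r H4; exact: ltW.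
    move: (kappa%:R) (b%:R) (M%:R) (a%:R) (p%:R) => k b' M' a' p'; nra.
  apply: le_trans h; rewrite lerD2l lerN2 ler_wpM2r // P2.
  by rewrite ler_peMr //; lra.
have W0 : 0 <= W by rewrite P2 mulr_ge0 //; lra.
have Wb : W * b%:R / M%:R <= W * d%:R / q%:R.
  rewrite ler_pdivrMr // mulrAC ler_pdivlMr //.
  by rewrite -!mulrA ler_wpM2l.
apply: le_trans Wb; rewrite ler_pdivlMr // -{2}(gtr0_norm M0) -normrM mulrBl divfK ?gt_eqF //.
by rewrite ler_norml; apply/andP; split; lra.
Qed.

End Estimates.

(** * Balls of the p-adic field and measurability *)

Local Open Scope classical_set_scope.
Local Open Scope ring_scope.

Section PadicBalls.
Context (p : nat) (p_pr : prime p).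
Local Notation Z_p := (padic_int p_pr).
Local Notation Q_p := (padic p_pr).
Local Notation emb := (@FracField.tofrac Z_p : Z_p -> Q_p).
Implicit Types x y : Q_p.

Let p_gt1 : (1 < p)%N. Proof. exact: prime_gt1. Qed.
Let p_gt0 : 0 < (p%:R : rat). Proof. by rewrite ltr0n prime_gt0. Qed.
Let pX_gt0 e : 0 < (p%:R : rat) ^- e. Proof. by rewrite invr_gt0 exprn_gt0. Qed.

Definition cball y (r : rat) : set Q_p := [set x | padic_abs (x - y) <= r].

Lemma padic_ultrametric x y z r :
  padic_abs (x - y) <= r -> padic_abs (y - z) <= r -> padic_abs (x - z) <= r.
Proof.
move=> xy yz; rewrite -(subrKA y); apply: le_trans (padic_absD _ _) _.
by rewrite ge_max xy yz.
Qed.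

Lemma padic_abs_sym x y : padic_abs (x - y) = padic_abs (y - x).
Proof. by rewrite -padic_absN opprB. Qed.

Lemma cball_measurable y r : 0 < r -> measurable (cball y r).
Proof.
move=> r0; apply: sub_sigma_algebra; rewrite openE => x hx.
apply/nbhs_ballP; exists r => // x' /= x'x.
apply: padic_ultrametric hx; rewrite padic_abs_sym; exact: ltW.
Qed.

Lemma padic_abs_pX e : padic_abs (p%:R ^+ e : Q_p) = p%:R ^- e.
Proof.
elim: e => [|e IH].
  have := padic_abs_tofrac (1 : Z_p); rewrite tofrac1 expr0 => ->.
  have : padic_int_abs (1 : Z_p) != 0 by rewrite padic_int_abs_eq0 oner_eq0.
  by move=> /mulfI; rewrite expr0 invr1; apply; rewrite -padic_int_absM !mulr1.
by rewrite exprS padic_absM IH padic_abs_p exprS invfM.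
Qed.

Lemma padic_pX_neq0 e : (p%:R ^+ e : Q_p) != 0.
Proof. by rewrite -padic_abs_eq0 padic_abs_pX gt_eqF. Qed.

Lemma cball_emb (a b : Z_p) e : cball (emb b) (p%:R ^- e) (emb a) <-> cong (p%:R ^+ e) a b.
Proof.
rewrite cong_subr0 padic_cong0P /cball /= -rmorphB padic_abs_tofrac padic_int_abs_le.
by split=> /eqP.
Qed.

Lemma Zp_cball : Defs.Zp p_pr = cball 0 1.
Proof. by apply/seteqP; split=> x /=; rewrite /cball /= subr0. Qed.

Lemma rat_pX_lt (r : rat) : exists e, r <= p%:R ^+ e.
Proof.
have [r0|/ltW r0] := leP 0 r; last by exists 0%N; rewrite expr0 (le_trans r0).
exists (Num.bound r); apply: le_trans (ltW (archi_boundP r0)) _.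
by rewrite -natrX ler_nat ltnW // ltn_expl.
Qed.

Lemma padic_scale (I : finType) (f : I -> Q_p) :
  exists e, forall i, exists z, p%:R ^+ e * f i = emb z.
Proof.
have ex i : exists e, padic_abs (f i) <= p%:R ^+ e by exact: rat_pX_lt.
have [e he] := choice ex; exists (\max_i e i)%N => i.
have : Defs.Zp p_pr (p%:R ^+ (\max_i e i)%N * f i).
  rewrite /Defs.Zp /= padic_absM padic_abs_pX mulrC ler_pdivrMr ?exprn_gt0 // mul1r.
  by apply: le_trans (he i) _; rewrite ler_eXn2l ?ltr1n // leq_bigmax.
by rewrite ZpE => -[z _ <-]; exists z.
Qed.

Lemma padic_dense x (r : rat) : 0 < r ->
  exists me : nat * nat, cball (me.1%:R / p%:R ^+ me.2) r x.
Proof.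
move=> r0; have [e /(_ tt) [z hz]] := padic_scale (fun _ : unit => x).
have [s hs] := rat_pX_lt r^-1.
exists (z (e + s)%N, e); rewrite /cball /=.
have -> : x = emb z / p%:R ^+ e by rewrite -hz mulrAC divff ?mul1r ?padic_pX_neq0.
rewrite -mulrBl padic_absM.
have -> : padic_abs ((p%:R ^+ e)^-1 : Q_p) = p%:R ^+ e.
  apply: (mulIf (_ : p%:R ^- e != 0)); first by rewrite gt_eqF.
  rewrite -{1}padic_abs_pX -padic_absM mulVf ?padic_pX_neq0 //.
  by rewrite mulfV ?gt_eqF ?exprn_gt0 // -(expr0 p%:R) padic_abs_pX expr0 invr1.
have := cball_emb z ((z (e + s)%N)%:R) (e + s); rewrite /cball /= rmorph_nat => -[_ h].
have := h (padic_nat_cong _ _); rewrite exprD invfM => {}h.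
rewrite -ler_pdivlMr ?exprn_gt0 //; apply: le_trans h _.
by rewrite mulrC ler_wpM2r ?(ltW (pX_gt0 _)) // -[r]invrK lef_pV2 ?posrE ?exprn_gt0 ?invr_gt0.
Qed.

End PadicBalls.

Section MeasurableCombination.
Context (p : nat) (p_pr : prime p) (disp : measure_display) (Omega : measurableType disp).
Local Notation Q_p := (padic p_pr).

(** Measurability tested on balls, in a form that is stable under linear
    combinations because the space is ultrametric and separable. *)
Definition ball_measurable (f : Omega -> Q_p) : Prop :=
  forall y r, 0 < r -> measurable (f @^-1` cball y r).

Lemma ball_measurable0 : ball_measurable (fun=> 0).
Proof.
move=> y r r0; have [h|h] := pselect (cball y r 0).
  by rewrite (_ : _ @^-1` _ = setT) //; apply/seteqP; split.
by rewrite (_ : _ @^-1` _ = set0) //; apply/seteqP; split.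
Qed.

(** If [f w] is within [r] of a point [D] of the dense set, then [f w + g w] is
    within [r] of [y] if and only if [g w] is within [r] of [y - D]. *)
Lemma ball_measurableD f g : ball_measurable f -> ball_measurable g ->
  ball_measurable (fun w => f w + g w).
Proof.
move=> mf mg y r r0.
pose D (me : nat * nat) : Q_p := me.1%:R / p%:R ^+ me.2.
rewrite (_ : _ @^-1` _ = \bigcup_me (f @^-1` cball (D me) r `&` g @^-1` cball (y - D me) r)).
  apply: countable_bigcupT_measurable; first exact: countableP.
  by move=> me; apply: measurableI; [exact: mf | exact: mg].
apply/seteqP; split=> w /=; rewrite /cball /=.
  move=> h; have [me hme] := padic_dense (f w) r0.
  exists me => //; split=> //=; rewrite /cball /=.
  have -> : g w - (y - D me) = (f w + g w - y) - (f w - D me) by ring.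
  apply: le_trans (padic_absD _ _) _.
  by rewrite padic_absN ge_max h.
case=> me _ [/= h1 h2]; have -> : f w + g w - y = (f w - D me) + (g w - (y - D me)) by ring.
by apply: le_trans (padic_absD _ _) _; rewrite ge_max; apply/andP.
Qed.

Lemma ball_measurableM f (c : Q_p) : ball_measurable f -> ball_measurable (fun w => f w * c).
Proof.
move=> mf; have [->|c0] := eqVneq c 0.
  by under eq_fun do rewrite mulr0; exact: ball_measurable0.
have c1 : 0 < padic_abs c by rewrite lt0r padic_abs_eq0 c0 padic_abs_ge0.
move=> y r r0; have := mf (y / c) (r / padic_abs c) (divr_gt0 r0 c1).
congr measurable; apply/seteqP; split=> w.
  by rewrite /cball /= ler_pdivlMr // -padic_absM mulrBl divfK.
by rewrite /cball /= ler_pdivlMr // -padic_absM mulrBl divfK.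
Qed.

Lemma ball_measurable_sum (I : Type) (s : seq I) (f : I -> Omega -> Q_p) :
  (forall i, ball_measurable (f i)) -> ball_measurable (fun w => \sum_(i <- s) f i w).
Proof.
move=> mf; elim: s => [|i s IH].
  by under eq_fun do rewrite big_nil; exact: ball_measurable0.
by under eq_fun do rewrite big_cons; exact: ball_measurableD.
Qed.

End MeasurableCombination.

(** * Boxes that contain a zero *)

Section Hits.
Context (p : nat) (p_pr : prime p) (d N n : nat) (N_lt : (N < p ^ n.+1)%N).
Local Notation Z_p := (padic_int p_pr).
Local Notation Q_p := (padic p_pr).
Local Notation emb := (@FracField.tofrac Z_p : Z_p -> Q_p).
Local Notation K := {ffun 'I_d -> 'I_N.+1}.
Implicit Types (z : 'I_d -> K -> Q_p) (c : 'I_d -> nat).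

Let p_gt0 : (0 < p)%N. Proof. exact: prime_gt0. Qed.
Let pX_gt0 e : (0 < p ^ e)%N. Proof. by rewrite expn_gt0 p_gt0. Qed.

Definition hit z m c : Prop := exists2 t, common_zeros z t &
  forall j, cball (c j)%:R (p%:R ^- m) (t 0 j).

Definition near_hit z m c r : Prop := exists2 a : {ffun 'I_d -> nat},
  forall j, a j = c j %[mod p ^ m] &
  forall i, cball 0 (p%:R ^- r) (binom_poly (z i) (\row_j (a j)%:R)).

Lemma cball_nat (x : Z_p) m b : cball (b%:R : Q_p) (p%:R ^- m) (emb x) <-> x m = b %[mod p ^ m].
Proof.
rewrite -(rmorph_nat (@FracField.tofrac Z_p)) cball_emb padic_congP padic_natE.
by rewrite padic_res_small.
Qed.

Lemma hit_emb (z : 'I_d -> K -> Z_p) m c :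
  hit (fun i k => emb (z i k)) m c <-> zero_in N_lt z m c.
Proof.
split=> [[t [tZ t0] tc]|[t [tc t0]]].
  have ex j : exists x, emb x = t 0 j by have := tZ j; rewrite ZpE => -[x _ <-]; exists x.
  have [x hx] := choice ex; exists x; split=> [j|i].
    by apply/cball_nat; rewrite hx.
  have := t0 i; have -> : t = \row_j emb (x j) by apply/rowP => j; rewrite !mxE hx.
  by rewrite (binom_polyE N_lt) => /eqP; rewrite tofrac_eq0 => /eqP.
exists (\row_j emb (t j)).
  split=> [j|i]; first by rewrite mxE ZpE; exists (t j).
  by rewrite (binom_polyE N_lt) t0 tofrac0.
by move=> j; rewrite mxE; apply/cball_nat.
Qed.

Lemma binom_poly_scale (a : Q_p) (z : K -> Q_p) t :
  binom_poly (fun k => a * z k) t = a * binom_poly z t.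
Proof. by rewrite /binom_poly mulr_sumr; apply: eq_bigr => k _; rewrite mulrA. Qed.

Lemma binom_poly_emb (z : K -> Z_p) (a : 'I_d -> nat) :
  binom_poly (fun k => emb (z k)) (\row_j (a j)%:R) = emb (\sum_k z k * (bin_prod k a)%:R).
Proof.
rewrite binom_poly_nat rmorph_sum; apply: eq_bigr => k _.
by rewrite rmorphM rmorph_nat.
Qed.

(** Compactness again, now for arbitrary coefficients: multiplying the system
    by a power of [p] does not change its zeros. *)
Lemma hitP z m c : hit z m c <-> forall r, near_hit z m c r.
Proof.
have [e he] := padic_scale (fun ik : 'I_d * K => z ik.1 ik.2).
have [y hy] := choice he.
pose z' i k := y (i, k).
have hz' i k : emb (z' i k) = p%:R ^+ e * z i k by rewrite /z' -(hy (i, k)).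
have ez' : (fun i k => emb (z' i k)) = (fun i k => p%:R ^+ e * z i k).
  by apply/funext => i; apply/funext => k.
have -> : hit z m c <-> hit (fun i k => emb (z' i k)) m c.
  rewrite ez'; split=> -[t [tZ t0] tc]; exists t => //; split=> // i.
    by rewrite binom_poly_scale t0 mulr0.
  by have /eqP := t0 i; rewrite binom_poly_scale mulf_eq0 (negbTE (padic_pX_neq0 _ _)) => /eqP.
have scaleE i (a : 'I_d -> nat) r : cball 0 (p%:R ^- r) (binom_poly (z i) (\row_j (a j)%:R)) <->
    cong (p%:R ^+ (e + r)) (sys z' i a) 0.
  rewrite -(cball_emb _ 0) tofrac0 /cball /= !subr0 -binom_poly_emb.
  rewrite (_ : (fun k => _) = (fun k => p%:R ^+ e * z i k)); last by apply/funext => k.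
  rewrite binom_poly_scale padic_absM padic_abs_pX exprD invfM.
  by rewrite ler_pM2l // invr_gt0 exprn_gt0 // ltr0n.
rewrite hit_emb zero_inP; split=> h r.
  have [a [ac a0]] := h (e + r)%N; exists [ffun j => a j] => [j|i].
    by rewrite ffunE.
  rewrite scaleE /sys; have := a0 i; congr cong; apply: eq_bigr => k _.
  by congr (_ * _%:R); apply: eq_bigr => j _; rewrite ffunE.
have [a ac a0] := h r; exists a; split=> // i.
by apply: padic_cong_le (leq_addl e r) _; apply/scaleE.
Qed.

Lemma measurable_hit (disp : measure_display) (Omega : measurableType disp)
    (Z : 'I_d -> K -> Omega -> Q_p) m c :
  (forall i k, measurable_fun setT (Z i k)) ->
  measurable [set w | hit (fun i k => Z i k w) m c].
Proof.
move=> mZ.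
have mF i (a : 'I_d -> nat) :
    ball_measurable (fun w => binom_poly (fun k => Z i k w) (\row_j (a j)%:R)).
  under eq_fun do rewrite binom_poly_nat.
  apply: ball_measurable_sum => k; apply: ball_measurableM => y r r0.
  rewrite -[X in measurable X]setTI; apply: mZ => //; exact: cball_measurable.
rewrite (_ : mkset _ = \bigcap_r \bigcup_(a : {ffun 'I_d -> nat})
    [set w | (forall j, a j = c j %[mod p ^ m]) /\
      forall i, cball 0 (p%:R ^- r) (binom_poly (fun k => Z i k w) (\row_j (a j)%:R))]).
  apply: bigcapT_measurable => r; apply: countable_bigcupT_measurable => [|a].
    exact: countableP.
  have [ac|nac] := pselect (forall j, a j = c j %[mod p ^ m]); last first.
    by rewrite (_ : mkset _ = set0) //; apply/seteqP; split=> w // -[].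
  rewrite (_ : mkset _ = \bigcap_(i in [set: 'I_d])
     ((fun w => binom_poly (fun k => Z i k w) (\row_j (a j)%:R)) @^-1` cball 0 (p%:R ^- r))).
    apply: fin_bigcap_measurable => // i _; apply: mF.
    by rewrite invr_gt0 exprn_gt0 // ltr0n.
  by apply/seteqP; split=> w => [[_ h] i _|h]; [exact: h | split=> // i; exact: h].
apply/seteqP; split=> w /=.
  by move/hitP => h r _; have [a ac a0] := h r; exists a.
by move=> h; apply/hitP => r; have [a _ [ac a0]] := h r I; exists a.
Qed.

Definition hits z m : {set {ffun 'I_d -> 'I_(p ^ m)}} :=
  [set c : {ffun 'I_d -> 'I_(p ^ m)} | `[< hit z m (fun j => c j) >]]%SET.

(** A point of [Z_p ^ d] lies in the box given by its residues modulo [p ^ m]. *)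
Definition box m (t : 'rV[Q_p]_d) : {ffun 'I_d -> 'I_(p ^ m)} :=
  [ffun j => Ordinal (ltn_pmod (xget (0 : Z_p) [set x | emb x = t 0 j] m) (pX_gt0 m))].

Lemma boxE m (t : 'rV[Q_p]_d) (x : 'I_d -> Z_p) j : emb (x j) = t 0 j ->
  box m t j = x j m :> nat.
Proof.
rewrite ffunE /= => <-; case: xgetP => [y _ /= /eqP|/(_ (x j))]; last by case.
by rewrite tofrac_eq => /eqP ->; rewrite padic_res_small.
Qed.

Lemma common_zeros_emb z t : common_zeros z t ->
  exists x : 'I_d -> Z_p, forall j, emb (x j) = t 0 j.
Proof.
case=> tZ _; have ex j : exists x, emb x = t 0 j.
  by have := tZ j; rewrite ZpE => -[x _ <-]; exists x.
by have [x hx] := choice ex; exists x.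
Qed.

Lemma hits_box z m (c : {ffun 'I_d -> 'I_(p ^ m)}) :
  reflect (exists2 t, common_zeros z t & box m t = c) (c \in hits z m).
Proof.
rewrite inE; apply: (iffP (asboolP _)) => -[t t0 tc]; exists t => //.
  have [x hx] := common_zeros_emb t0; apply/ffunP => j; apply: val_inj.
  rewrite /= (boxE m (hx j)); have := tc j; rewrite -hx => /cball_nat.
  by rewrite padic_res_small modn_small.
have [x hx] := common_zeros_emb t0; move=> j; rewrite -hx; apply/cball_nat.
by rewrite -tc (boxE m (hx j)).
Qed.

Lemma card_hitsS z m : (#|hits z m| <= #|hits z m.+1|)%N.
Proof.
pose tr (c : {ffun 'I_d -> 'I_(p ^ m.+1)}) : {ffun 'I_d -> 'I_(p ^ m)} :=
  [ffun j => Ordinal (ltn_pmod (c j) (pX_gt0 m))].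
apply: leq_trans (leq_imset_card tr _).
apply: fintype.subset_leq_card; apply/fintype.subsetP => c /hits_box[t t0 <-].
apply/imsetP; exists (box m.+1 t); first by apply/hits_box; exists t.
have [x hx] := common_zeros_emb t0; apply/ffunP => j; apply: val_inj.
by rewrite [in RHS]ffunE /= (boxE m (hx j)) (boxE m.+1 (hx j)) padic_res_mod.
Qed.

Lemma card_hits_mono z : {homo (fun m => #|hits z m|) : a b / (a <= b)%N}.
Proof. by apply: homo_leq => // [? ? ?|]; [exact: leq_trans | exact: card_hitsS]. Qed.

Lemma box_separate z t t' : common_zeros z t -> common_zeros z t' -> t != t' ->
  exists m, forall m', (m <= m')%N -> box m' t != box m' t'.
Proof.
move=> /common_zeros_emb[x hx] /common_zeros_emb[x' hx'] tt'.
have [j xj] : exists j, x j <> x' j.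
  apply/existsNP => h; case/eqP: tt'; apply/rowP => j.
  by rewrite -hx -hx' h.
have [m xm] : exists m, x j m <> x' j m.
  by apply/existsNP => h; apply: xj; exact: padic_int_eq.
exists m => m' mm'; apply/eqP => /ffunP /(_ j) /(congr1 val) /=.
rewrite (boxE m' (hx j)) (boxE m' (hx' j)) => e; apply: xm.
by rewrite -(padic_res_mod (x j) mm') -(padic_res_mod (x' j) mm') e.
Qed.

(** Finitely many zeros lie in different boxes once the boxes are small. *)
Lemma hits_ge z (s : seq 'rV[Q_p]_d) : uniq s -> {in s, forall t, common_zeros z t} ->
  exists m, (size s <= #|hits z m|)%N.
Proof.
move=> us hs.
have ex (tt : 'rV[Q_p]_d * 'rV[Q_p]_d) : exists m,
    tt.1 \in s -> tt.2 \in s -> tt.1 != tt.2 ->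
    forall m', (m <= m')%N -> box m' tt.1 != box m' tt.2.
  have [[h1 [h2 ne]]|h] := pselect (tt.1 \in s /\ tt.2 \in s /\ tt.1 != tt.2).
    by have [m hm] := box_separate (hs _ h1) (hs _ h2) ne; exists m.
  by exists 0%N => h1 h2 ne; case: h.
have [M hM] := choice ex.
pose m := (\max_(tt <- [seq (t, t') | t <- s, t' <- s]) M tt)%N; exists m.
have inj : {in s &, injective (box m)}.
  move=> t t' ht ht' e; apply/eqP/negPn/negP => ne.
  have := hM (t, t') ht ht' ne m; rewrite e eqxx => /(_ _)/negP; apply => //.
  by apply: (leq_bigmax_seq (t, t')) => //; apply: allpairs_f.
rewrite -(size_map (box m)); have /card_uniqP <- : uniq (map (box m) s).
  by rewrite map_inj_in_uniq.
apply: fintype.subset_leq_card; apply/fintype.subsetP => c /mapP[t ts ->].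
by apply/hits_box; exists t => //; exact: hs.
Qed.

(** Zeros are separated by small boxes, so that the number of boxes that contain
    a zero increases to the number of zeros. *)
Lemma counting_hits (R : realType) z m0 :
  counting (common_zeros z) =
  ereal_sup (range (fun m => (#|hits z (m0 + m)|%:R)%:E : \bar R)).
Proof.
have big (s : seq 'rV[Q_p]_d) : uniq s -> {in s, forall t, common_zeros z t} ->
    ((size s)%:R%:E <= ereal_sup (range (fun m => (#|hits z (m0 + m)|%:R)%:E : \bar R)))%E.
  move=> us hs; have [m hm] := hits_ge us hs.
  apply: le_trans (ereal_sup_ubound _); last by exists m.
  rewrite lee_fin ler_nat; apply: leq_trans hm _.
  by apply: card_hits_mono; exact: leq_addl.
rewrite /counting; case: asboolP => fin.
  apply/eqP; rewrite eq_le; apply/andP; split.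
    apply: big; first exact: finmap.fset_uniq.
    by move=> t; rewrite in_fset_set // inE.
  apply: ge_ereal_sup => _ [m _ <-]; rewrite lee_fin ler_nat.
  set A := finmap.enum_fset _; rewrite -(size_map (box (m0 + m))).
  apply: leq_trans (card_size _).
  apply: fintype.subset_leq_card; apply/fintype.subsetP => c /hits_box[t t0 <-].
  by apply: map_f; rewrite in_fset_set // inE.
apply/esym/eqP; rewrite -leye_eq leNgt; apply/negP => h.
set S := ereal_sup _ in big h.
have S0 : (0 <= S)%E by have := big [::] isT; apply => t; rewrite in_nil.
have Sfin : S \is a fin_num by rewrite fin_numElt h (lt_le_trans (ltNyr 0)).
have [B Bsub Bsz] := infinite_set_fset (Num.bound (fine S)).+1 fin.
have := big _ (finmap.fset_uniq B) Bsub; apply/negP; rewrite -ltNge.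
rewrite -(fineK Sfin) lte_fin; apply: lt_le_trans (archi_boundP _) _.
  by rewrite fine_ge0.
by rewrite ler_nat ltnW.
Qed.

End Hits.

(** * Uniformity of the reduced coefficients *)

Section HaarBalls.
Context (R : realType) (p : nat) (p_pr : prime p).
Local Notation Z_p := (padic_int p_pr).
Local Notation Q_p := (padic p_pr).
Local Notation emb := (@FracField.tofrac Z_p : Z_p -> Q_p).

Let p_gt0 : (0 < p)%N. Proof. exact: prime_gt0. Qed.
Let pX_gt0 e : (0 < p ^ e)%N. Proof. by rewrite expn_gt0 p_gt0. Qed.
Let ball_gt0 e : 0 < (p%:R ^- e : rat). Proof. by rewrite invr_gt0 exprn_gt0 // ltr0n. Qed.

Lemma Zp_measurable : measurable (Defs.Zp p_pr).
Proof. by rewrite Zp_cball; exact: cball_measurable. Qed.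

Lemma nat_Zp (a : nat) : Defs.Zp p_pr a%:R.
Proof. by rewrite ZpE; exists a%:R => //; rewrite rmorph_nat. Qed.

(** [Z_p] is the disjoint union of [p ^ r] translates of each ball of radius
    [p ^- r]. *)
Lemma haar_ball (mu : {measure set Q_p -> \bar R}) (a r : nat) :
  normalized_haar_Zp mu -> mu (cball a%:R (p%:R ^- r)) = (p%:R ^- r)%:E.
Proof.
case=> mu1 _ mu_tr.
have sub0 : cball 0 (p%:R ^- r) `<=` Defs.Zp p_pr.
  move=> x; rewrite Zp_cball /cball /= => h; apply: le_trans h _.
  by rewrite invf_le1 ?exprn_gt0 ?ltr0n // exprn_ege1 // ler1n.
have tr (b : nat) : mu (cball b%:R (p%:R ^- r)) = mu (cball 0 (p%:R ^- r)).
  rewrite -(mu_tr b%:R _ (nat_Zp b) (cball_measurable _ (ball_gt0 r)) sub0).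
  congr (mu _); apply/seteqP; split=> [x hx|_ [x hx <-]].
    by exists (x - b%:R); rewrite ?subrKC // /cball /= subr0.
  by move: hx; rewrite /cball /= subr0 addrAC subrr add0r.
rewrite tr; set m := mu _.
have cover : Defs.Zp p_pr = \big[setU/set0]_(b < p ^ r) cball (b%:R : Q_p) (p%:R ^- r).
  rewrite -(bigcup_mkord _ (fun b : nat => cball (b%:R : Q_p) (p%:R ^- r))).
  apply/seteqP; split=> x.
    rewrite ZpE => -[y _ <-].
    have yr : (y r < p ^ r)%N by rewrite -padic_res_small ltn_mod.
    by exists (y r) => //; apply/cball_nat; rewrite padic_res_small.
  case=> b _ /=; rewrite !Zp_cball /cball /= => h.
  apply: (padic_ultrametric (y := b%:R)).
    by apply: le_trans h _; rewrite invf_le1 ?exprn_gt0 ?ltr0n // exprn_ege1 // ler1n.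
  by have := nat_Zp b; rewrite Zp_cball.
have disj : trivIset [set: 'I_(p ^ r)] (fun b => cball (b%:R : Q_p) (p%:R ^- r)).
  move=> b b' _ _ [x [/= xb xb']].
  have : cball (b'%:R : Q_p) (p%:R ^- r) (emb b%:R).
    rewrite rmorph_nat; apply: padic_ultrametric xb'.
    by rewrite padic_abs_sym.
  by move/cball_nat; rewrite padic_natE !modn_small // => /val_inj.
have := mu1; rewrite cover measure_bigsetU_ord //; last by move=> b; exact: cball_measurable.
rewrite (eq_bigr (fun=> m)) => [|b _]; last exact: tr.
have m0 : (0 <= m)%E by exact: measure_ge0.
have mle : (m <= 1)%E.
  rewrite -mu1; apply: le_measure; rewrite ?inE //; first exact: cball_measurable.
  exact: Zp_measurable.
have mfin : m \is a fin_num by rewrite ge0_fin_numE // (le_lt_trans mle) ?ltry.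
rewrite -(fineK mfin) sumEFin => -[]; rewrite sumr_const card_ord -[_ *+ (p ^ r)]mulr_natr natrX => e.
congr EFin; apply: (mulIf (_ : p%:R ^+ r != 0)); first by rewrite expf_neq0 // pnatr_eq0 -lt0n.
by rewrite e mulVf // expf_neq0 // pnatr_eq0 -lt0n.
Qed.

End HaarBalls.

Section RandomSystem.
Context (R : realType) (p : nat) (p_pr : prime p) (d N n : nat).
Context (N_lt : (N < p ^ n.+1)%N) (pn_le : (p ^ n <= N)%N).
Context (disp : measure_display) (Omega : measurableType disp).
Context (P : probability Omega R).
Local Notation Z_p := (padic_int p_pr).
Local Notation Q_p := (padic p_pr).
Local Notation emb := (@FracField.tofrac Z_p : Z_p -> Q_p).
Local Notation K := {ffun 'I_d -> 'I_N.+1}.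
Context (Z : 'I_d -> K -> {RV P >-> Q_p}).
Context (Z_indep : mutually_independent (fun ik : 'I_d * K => Z ik.1 ik.2)).
Context (Z_gauss : forall i k, standard_padic_gaussian (Z i k)).
Implicit Types w : Omega.

Let p_gt0 : (0 < p)%N. Proof. exact: prime_gt0. Qed.
Let pX_gt0 e : (0 < p ^ e)%N. Proof. by rewrite expn_gt0 p_gt0. Qed.
Let ball_gt0 e : 0 < (p%:R ^- e : rat). Proof. by rewrite invr_gt0 exprn_gt0 // ltr0n. Qed.

(** The coefficients as elements of the ring [Z_p], with the value [0] on the
    null event where they leave it. *)
Definition coef w (i : 'I_d) (k : K) : Z_p := xget 0 [set x | emb x = Z i k w].

Definition integral_event : set Omega := [set w | forall i k, Defs.Zp p_pr (Z i k w)].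

Lemma coefE w i k : Defs.Zp p_pr (Z i k w) -> emb (coef w i k) = Z i k w.
Proof.
rewrite ZpE => -[y _ hy]; rewrite /coef; case: xgetP => [x _ //|/(_ y)].
by case.
Qed.

Lemma Z_preim_measurable i k (B : set Q_p) : measurable B -> measurable (Z i k @^-1` B).
Proof. by move=> mB; rewrite -[X in measurable X]setTI; exact: measurable_funP. Qed.

Lemma integral_eventE : integral_event =
  \bigcap_(ik in [set: 'I_d * K]) (Z ik.1 ik.2 @^-1` Defs.Zp p_pr).
Proof. by apply/seteqP; split=> w h => [ik _|i k]; [exact: h | exact: (h (i, k))]. Qed.

Lemma integral_event_measurable : measurable integral_event.
Proof.
rewrite integral_eventE; apply: fin_bigcap_measurable => // ik _.
by apply: Z_preim_measurable; exact: Zp_measurable.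
Qed.

Lemma integral_event_as : P (~` integral_event) = 0%E.
Proof.
rewrite probability_setC; last exact: integral_event_measurable.
have -> : integral_event =
    \bigcap_(ik in [set` [set: 'I_d * K]%SET]) (Z ik.1 ik.2 @^-1` Defs.Zp p_pr).
  by rewrite integral_eventE; apply: eq_bigcapl; split=> ik _ //=; rewrite inE.
rewrite Z_indep => [|ik]; last exact: Zp_measurable.
rewrite big1 ?subee // => ik _.
by have [] := Z_gauss ik.1 ik.2.
Qed.

(** The values of a coefficient for which the residue of [coef] is [a]. *)
Let resB r (a : nat) : set Q_p :=
  cball a%:R (p%:R ^- r) `|` (if a == 0%N then ~` Defs.Zp p_pr else set0).

Let resB_measurable r a : measurable (resB r a).
Proof.
apply: measurableU; first exact: cball_measurable.
by case: ifP => // _; apply: measurableC; exact: Zp_measurable.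
Qed.

Let resBP r a w i k : (a < p ^ r)%N -> resB r a (Z i k w) <-> coef w i k r = a.
Proof.
move=> ar; have [h|h] := pselect (Defs.Zp p_pr (Z i k w)).
  rewrite /resB /= -(coefE h); split=> [[/cball_nat|]|<-].
  - by rewrite padic_res_small modn_small.
  - by case: ifP => // _ /=; rewrite coefE.
  - by left; apply/cball_nat; rewrite padic_res_small.
have c0 : coef w i k = 0.
  rewrite /coef; case: xgetP => // x _ /= e; case: h; rewrite -e ZpE.
  by exists x.
rewrite c0 padic_zeroE; split=> [|<-]; last by right; rewrite eqxx.
case=> [/= hb|]; last by case: eqP.
case: h; have := nat_Zp p_pr a; rewrite !Zp_cball /cball /= => ha.
apply: (padic_ultrametric (y := a%:R)) ha; apply: le_trans hb _.
by rewrite invf_le1 ?exprn_gt0 ?ltr0n // exprn_ege1 // ler1n.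
Qed.

Let P_resB r a i k : P (Z i k @^-1` resB r a) = (p%:R ^- r)%:E.
Proof.
have [mu1 mu0 _] := Z_gauss i k.
rewrite -(haar_ball a r (Z_gauss i k)).
have <- : distribution P (Z i k) (resB r a) = P (Z i k @^-1` resB r a) by [].
rewrite /resB; case: ifP => _; last by rewrite setU0.
rewrite measureU0 //; first exact: cball_measurable.
by apply: measurableC; exact: Zp_measurable.
Qed.

Section Level.
Context (l : nat) (l_gt0 : (0 < l)%N).
Local Notation q := (p ^ l)%N.
Local Notation q2 := (p ^ (l + l))%N.
Local Notation Data := {ffun 'I_d * K -> 'Z_q2}.

Let q_gt1 : (1 < q)%N.
Proof. by rewrite -(exp1n l) ltn_exp2r ?prime_gt1. Qed.
Let q2_gt1 : (1 < q2)%N.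
Proof. by rewrite expnD -[1%N]muln1 ltn_mul. Qed.

Let X w : Data := coef_res l_gt0 (coef w).

Let XE x : [set w | X w = x] =
  \bigcap_(ik in [set` [set: 'I_d * K]%SET]) (Z ik.1 ik.2 @^-1` resB (l + l) (x ik : nat)).
Proof.
have lt_q2 (a : 'Z_q2) : (a < q2)%N by rewrite -{2}(Zp_cast q2_gt1).
have x_lt ik : (x ik < q2)%N by exact: lt_q2.
apply/seteqP; split=> w /= => [<- ik _|h].
  apply/resBP => //; rewrite ffunE resE val_Zp_nat // padic_res_small //.
apply/ffunP => ik; have /resBP := h ik (finset.in_setT ik) => /(_ (x_lt ik)) e.
by rewrite ffunE resE e natr_Zp.
Qed.

Let X_measurable x : measurable [set w | X w = x].
Proof.
rewrite XE; apply: fin_bigcap_measurable => [|ik _]; first exact: finite_finset.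
exact: Z_preim_measurable.
Qed.

Let P_X x : P [set w | X w = x] = ((#|{: Data}|%:R)^-1)%:E.
Proof.
rewrite XE Z_indep => [|ik]; last exact: resB_measurable.
under eq_bigr do rewrite P_resB.
rewrite prodEFin prodr_const cardsT card_ffun card_Zq // natrX natrX exprVn.
by [].
Qed.

Lemma coef_res_measurable (S : {pred Data}) : measurable [set w | X w \in S].
Proof.
rewrite (_ : mkset _ = \bigcup_(x in [set` [set x in S]%SET]) [set w | X w = x]).
  by apply: fin_bigcup_measurable => [|x _]; [exact: finite_finset | exact: X_measurable].
apply/seteqP; split=> w /= => [h|[x /=]]; first by exists (X w) => //=; rewrite inE.
by rewrite inE => h ->.
Qed.

(** By independence the joint law of the residues is the product of the uniform
    laws given by [haar_ball]. *)
Lemma coef_res_uniform (S : {pred Data}) :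
  P [set w | X w \in S] = (#|S|%:R / #|{: Data}|%:R)%:E.
Proof.
have main (s : seq Data) : uniq s ->
    P [set w | X w \in s] = ((size s)%:R / #|{: Data}|%:R)%:E.
  elim: s => [_|x s IH /= /andP[xs us]].
    by rewrite (_ : mkset _ = set0) ?measure0 ?mul0r //; apply/seteqP; split.
  rewrite (_ : mkset _ = [set w | X w = x] `|` [set w | X w \in s]); last first.
    apply/seteqP; split=> w /=; rewrite inE.
      by case/orP => [/eqP|]; [left | right].
    by case=> [->|->]; rewrite ?eqxx ?orbT.
  have disj : [set w | X w = x] `&` [set w | X w \in s] = set0.
    by apply/seteqP; split=> w //= [-> xs']; rewrite xs' in xs.
  have ms : measurable [set w | X w \in s].
    exact: (coef_res_measurable [pred y | y \in s]).
  have -> : P ([set w | X w = x] `|` [set w | X w \in s]) =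
      (P [set w | X w = x] + P [set w | X w \in s])%E.
    by apply: measureU => //; exact: X_measurable.
  rewrite P_X IH // -EFinD.
  by rewrite -(add1n (size s)) natrD mulrDl mul1r.
rewrite cardE -main ?enum_uniq //; congr (P _); apply/seteqP; split=> w /=.
  by rewrite mem_enum.
by rewrite mem_enum.
Qed.

Let hit_event (c : 'I_d -> nat) : set Omega :=
  [set w | hit (fun i k => Z i k w) (n + l) c].

Let jet_event c (S : pred ('cV['Z_q2]_d * 'M['Z_q]_d)) : set Omega :=
  [set w | X w \in [pred x | jet p_pr n l_gt0 c x \in S]].

Lemma jet_uniform c (S : pred ('cV['Z_q2]_d * 'M['Z_q]_d)) :
  P (jet_event c S) = (#|S|%:R / (q%:R ^+ (2 * d) * q%:R ^+ (d * d)))%:E.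
Proof.
rewrite coef_res_uniform; congr EFin.
have D0 : (#|{: Data}|%:R : R) != 0.
  by rewrite pnatr_eq0 -lt0n; apply/card_gt0P; exists 0.
have q0 : (q%:R : R) != 0 by rewrite pnatr_eq0 -lt0n.
have := card_jet_preim p_pr pn_le l_gt0 c S.
move=> /(congr1 (fun x : nat => x%:R : R)); rewrite !natrM => e.
apply/eqP; rewrite eqr_div // ?mulf_neq0 ?expf_neq0 //; apply/eqP.
rewrite -e; congr (_ * (_ * _)); rewrite ?natrX //.
by rewrite -!exprM; congr (_ ^+ _); lia.
Qed.

Lemma hit_integral c w : integral_event w ->
  hit_event c w <-> zero_in N_lt (coef w) (n + l) c.
Proof.
move=> h; rewrite -hit_emb.
have -> // : (fun i k => emb (coef w i k)) = (fun i k => Z i k w).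
by apply/funext => i; apply/funext => k; rewrite coefE.
Qed.

Lemma hit_event_measurable c : measurable (hit_event c).
Proof. by apply: (measurable_hit N_lt) => i k; exact: measurable_funP. Qed.

(** A box that contains a zero has a solvable jet, and the converse can only
    fail for a singular Jacobian matrix. *)
Lemma hit_prob_bounds c : (forall j, c j < p ^ (n + l))%N ->
  ((q%:R ^- d * (solvable_prob R p_pr d l_gt0 - singular_prob R p_pr d l_gt0))%:E
    <= P (hit_event c) <= (q%:R ^- d * solvable_prob R p_pr d l_gt0)%:E)%E.
Proof.
move=> c_lt.
have null : P (~` integral_event) = 0%E by exact: integral_event_as.
have mnull : measurable (~` integral_event).
  by apply: measurableC; exact: integral_event_measurable.
have q0 : (q%:R : R) != 0 by rewrite pnatr_eq0 -lt0n.
have q1 : 0 < (q%:R : R) by rewrite ltr0n.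
pose S := @solvable p p_pr d l l_gt0.
pose S' := [pred y | (y \in S) && ~~ singular p_pr l_gt0 y.2].
have mjet T : measurable (jet_event c T) by exact: coef_res_measurable.
have upper : (P (hit_event c) <= P (jet_event c S))%E.
  rewrite -(measureU0 (mjet S) mnull null); apply: le_measure; rewrite ?inE //.
  - exact: hit_event_measurable.
  - exact: measurableU.
  move=> w hw; have [h|h] := pselect (integral_event w); last by right.
  left; apply: (zero_in_solvable l_gt0 c_lt); exact/hit_integral.
have lower : (P (jet_event c S') <= P (hit_event c))%E.
  rewrite -(measureU0 (hit_event_measurable c) mnull null); apply: le_measure; rewrite ?inE //.
    by apply: measurableU => //; exact: hit_event_measurable.
  move=> w /andP[hw ns].
  have [h|h] := pselect (integral_event w); last by right.
  by left; apply/hit_integral => //; exact: solvable_zero_in hw ns.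
have SE : #|S|%:R / (q%:R ^+ (2 * d) * q%:R ^+ (d * d)) =
    q%:R ^- d * solvable_prob R p_pr d l_gt0 :> R.
  rewrite /S card_solvable /solvable_prob.
  have -> : q%:R ^+ (d * (1 + d)) = q%:R ^+ d * q%:R ^+ (d * d) :> R.
    by rewrite -exprD; congr (_ ^+ _); lia.
  have -> : q%:R ^+ (2 * d) = q%:R ^+ d * q%:R ^+ d :> R.
    by rewrite -exprD; congr (_ ^+ _); lia.
  by field; rewrite !expf_neq0.
apply/andP; split; last by apply: le_trans upper _; rewrite jet_uniform SE.
apply: le_trans lower; rewrite jet_uniform lee_fin mulrBr -SE.
have -> : q%:R ^- d * singular_prob R p_pr d l_gt0 =
    (q ^ d * #|@singular _ p_pr _ l_gt0 d d|)%:R / (q%:R ^+ (2 * d) * q%:R ^+ (d * d)).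
  rewrite /singular_prob natrM [(q ^ d)%:R]natrX.
  have -> : q%:R ^+ (2 * d) = q%:R ^+ d * q%:R ^+ d :> R.
    by rewrite -exprD; congr (_ ^+ _); lia.
  by field; rewrite !expf_neq0.
rewrite -mulrBl ler_wpM2r ?invr_ge0 ?mulr_ge0 ?exprn_ge0 //.
rewrite lerBlDr -natrD ler_nat.
apply: leq_trans (leq_add (leqnn _) (card_solvable_singular p_pr d l_gt0)).
rewrite -(cardID [pred y | singular p_pr l_gt0 y.2] S) addnC; apply: eq_leq.
by congr (_ + _)%N; apply: eq_card => y; rewrite !inE // andbC.
Qed.

End Level.

End RandomSystem.

(** * The expected number of zeros *)

Section Expectation.
Context (R : realType) (p : nat) (p_pr : prime p) (d N n : nat).
Context (N_lt : (N < p ^ n.+1)%N) (pn_le : (p ^ n <= N)%N).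
Context (disp : measure_display) (Omega : measurableType disp).
Context (P : probability Omega R).
Local Notation K := {ffun 'I_d -> 'I_N.+1}.
Context (Z : 'I_d -> K -> {RV P >-> padic p_pr}).
Context (Z_indep : mutually_independent (fun ik : 'I_d * K => Z ik.1 ik.2)).
Context (Z_gauss : forall i k, standard_padic_gaussian (Z i k)).
Local Notation L := ((\sum_(j < d.+1) p%:R ^- j)^-1 : R).

Let p_gt0 : (0 < p)%N. Proof. exact: prime_gt0. Qed.
Let p_gt1 : (1 < p)%N. Proof. exact: prime_gt1. Qed.

Definition nb_hits m (w : Omega) : \bar R :=
  (#|hits (fun i k => Z i k w) m|%:R)%:E.

Let hit_set m (c : 'I_d -> nat) : set Omega := [set w | hit (fun i k => Z i k w) m c].

Lemma nb_hitsE m w :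
  nb_hits m w = \sum_(c : {ffun 'I_d -> 'I_(p ^ m)}) (\1_(hit_set m (fun j => c j)) w)%:E.
Proof.
rewrite sumEFin; congr EFin; rewrite -sum1_card natr_sum big_mkcond /=.
apply: eq_bigr => c _; rewrite indicE inE /hit_set.
case: asboolP => h; first by rewrite mem_set.
by rewrite memNset.
Qed.

Lemma hit_set_measurable m c : measurable (hit_set m c).
Proof. by apply: (measurable_hit N_lt) => i k; exact: measurable_funP. Qed.

Let indic_measurable m c :
  measurable_fun setT (fun w => (\1_(hit_set m c) w)%:E : \bar R).
Proof.
apply/measurable_EFinP; apply: measurable_indic; exact: hit_set_measurable.
Qed.

Lemma nb_hits_measurable m : measurable_fun setT (nb_hits m).
Proof.
rewrite (funext (nb_hitsE m)).
by apply: emeasurable_sum => c; exact: indic_measurable.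
Qed.

Lemma expected_hits m : (\int[P]_w nb_hits m w =
  \sum_(c : {ffun 'I_d -> 'I_(p ^ m)}) P (hit_set m (fun j => c j)))%E.
Proof.
under eq_integral do rewrite nb_hitsE.
rewrite ge0_integral_sum; last 3 first.
- exact: measurableT.
- by move=> c; exact: indic_measurable.
- by move=> c w _; rewrite lee_fin.
by apply: eq_bigr => c _; rewrite integral_indic ?setIT //; exact: hit_set_measurable.
Qed.

Lemma expected_hits_bounds l (l_gt0 : (0 < l)%N) :
  ((((p ^ n) ^ d)%:R * (solvable_prob R p_pr d l_gt0 - singular_prob R p_pr d l_gt0))%:E
    <= (\int[P]_w nb_hits (n + l) w)
    <= (((p ^ n) ^ d)%:R * solvable_prob R p_pr d l_gt0)%:E)%E.
Proof.
have sum_const (x : R) : (((p ^ n) ^ d)%:R * x)%:E =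
    (\sum_(c : {ffun 'I_d -> 'I_(p ^ (n + l))}) ((p ^ l)%:R ^- d * x)%:E)%E.
  rewrite sumEFin sumr_const card_ffun !card_ord -[_ * x *+ _]mulr_natl mulrA.
  congr (_ * _)%:E; rewrite -[(p ^ l)%:R ^+ d]natrX.
  have -> : ((p ^ (n + l)) ^ d = (p ^ n) ^ d * (p ^ l) ^ d)%N by rewrite -expnMn -expnD.
  by rewrite natrM mulfK // pnatr_eq0 -lt0n !expn_gt0 p_gt0.
rewrite expected_hits !sum_const; apply/andP; split; apply: lee_sum => c _.
  by have /andP[] := hit_prob_bounds N_lt pn_le Z_indep Z_gauss l_gt0 (fun j => ltn_ord (c j)).
by have /andP[] := hit_prob_bounds N_lt pn_le Z_indep Z_gauss l_gt0 (fun j => ltn_ord (c j)).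
Qed.

Let nb_zeros w : \bar R := counting (common_zeros (fun i k => Z i k w)).

Let nb_hits_mono w : {homo (fun m => nb_hits (n.+1 + m) w) : a b / (a <= b)%N >-> (a <= b)%E}.
Proof.
move=> a b ab; rewrite lee_fin ler_nat.
by apply: card_hits_mono; rewrite leq_add2l.
Qed.

Lemma nb_hits_cvg w : nb_hits (n.+1 + m) w @[m --> \oo] --> nb_zeros w.
Proof.
rewrite /nb_zeros (counting_hits R _ n.+1).
exact: ereal_nondecreasing_cvgn (nb_hits_mono w).
Qed.

Lemma nb_zeros_measurable : measurable_fun setT nb_zeros.
Proof.
apply: (emeasurable_fun_cvg (fun m => nb_hits (n.+1 + m))) => [m|w _].
  exact: nb_hits_measurable.
exact: nb_hits_cvg.
Qed.

(** The two bounds of [expected_hits_bounds] tend to the same limit. *)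
Lemma expected_hits_cvg :
  (\int[P]_w nb_hits (n.+1 + m) w)%E @[m --> \oo] --> (((p ^ n) ^ d)%:R * L)%:E.
Proof.
pose C : R := (p%:R ^+ (2 * d).+1 + 1) * d%:R.
pose e m : R := C * p%:R^-1 ^+ m.+1.
have e0 : e m @[m --> \oo] --> 0.
  rewrite -(mulr0 C); apply: cvgMr.
  rewrite (cvg_shiftS (fun m => (p%:R : R)^-1 ^+ m)); apply: cvg_expr.
  by rewrite ger0_norm ?invr_ge0 // invf_lt1 ?ltr1n ?ltr0n.
have lim (s : R) : (((p ^ n) ^ d)%:R * (L + s * e m))%:E @[m --> \oo] --> (((p ^ n) ^ d)%:R * L)%:E.
  have h : ((p ^ n) ^ d)%:R * (L + s * e m) @[m --> \oo] --> ((p ^ n) ^ d)%:R * (L + s * 0).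
    by apply: cvgMr; apply: cvgD; [exact: cvg_cst | exact: cvgMr].
  by rewrite mulr0 addr0 in h; apply: cvg_EFin h; near=> m.
apply: squeeze_cvge (lim (-1)) (lim 1); near=> m.
rewrite addSnnS.
have /andP[lo up] := expected_hits_bounds (ltn0Sn m).
have near_L := solvable_prob_near R p_pr d (ltn0Sn m).
have small := singular_prob_le R p_pr d (ltn0Sn m).
have W1 : 0 <= p%:R ^+ (2 * d).+1 * d%:R / (p ^ m.+1)%:R :> R.
  by rewrite divr_ge0 ?mulr_ge0 ?exprn_ge0.
have D1 : 0 <= d%:R / (p ^ m.+1)%:R :> R by rewrite divr_ge0.
have eE : e m = p%:R ^+ (2 * d).+1 * d%:R / (p ^ m.+1)%:R + d%:R / (p ^ m.+1)%:R.
  by rewrite /e /C exprVn [(p ^ m.+1)%:R]natrX; ring.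
move: near_L; rewrite ler_norml => /andP[n1 n2].
apply/andP; split.
  apply: le_trans lo; rewrite lee_fin ler_wpM2l // eE; lra.
apply: le_trans up _; rewrite lee_fin ler_wpM2l // eE; lra.
Unshelve. all: by end_near.
Qed.

Lemma expected_nb_zeros : (\int[P]_w nb_zeros w = (((p ^ n) ^ d)%:R * L)%:E)%E.
Proof.
have limE w : nb_zeros w = limn (fun m => nb_hits (n.+1 + m) w).
  by apply/esym/cvg_lim => //; exact: nb_hits_cvg.
under eq_integral do rewrite limE.
rewrite (monotone_convergence P measurableT).
- by apply: cvg_lim => //; exact: expected_hits_cvg.
- by move=> m; exact: nb_hits_measurable.
- by move=> m w _; rewrite lee_fin.
- by move=> w _; exact: nb_hits_mono.
Qed.

End Expectation.

Lemma floor_logb (R : realType) (p N : nat) : (1 < p)%N -> (0 < N)%N ->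
  Num.floor (logb p%:R N%:R : R) = (trunc_log p N)%:Z.
Proof.
move=> p1 N0; set n := trunc_log p N.
have /andP[pn_le N_lt] := trunc_log_bounds p1 N0.
have lnp : 0 < ln (p%:R : R) by rewrite ln_gt0 // ltr1n.
have lnX m : ln ((p ^ m)%:R : R) = m%:R * ln p%:R.
  by rewrite natrX lnXn ?ltr0n ?(ltnW p1) // mulr_natl.
have pX m : (p ^ m)%:R \is @Num.pos R by rewrite posrE ltr0n expn_gt0 ltnW.
have N_pos : (N%:R : R) \is Num.pos by rewrite posrE ltr0n.
apply: floor_def; rewrite /logb ler_pdivlMr // ltr_pdivrMr //.
rewrite -[(n%:Z + 1)]/(n%:Z + 1%:Z) -PoszD addn1 -!pmulrn -!lnX.
by rewrite ler_ln // ltr_ln // ler_nat ltr_nat pn_le N_lt.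
Qed.

Theorem mainTheorem2 (R : realType) (p : nat) (p_pr : prime p) (d N : nat)
    (d_gt0 : (1 <= d)%N) (N_gt0 : (1 <= N)%N)
    (disp : measure_display) (Omega : measurableType disp)
    (P : probability Omega R)
    (Z : 'I_d -> {ffun 'I_d -> 'I_N.+1} -> {RV P >-> padic p_pr})
    (Z_indep : mutually_independent
       (fun ik : 'I_d * {ffun 'I_d -> 'I_N.+1} => Z ik.1 ik.2))
    (Z_gauss : forall i k, standard_padic_gaussian (Z i k)) :
  let nb_zeros : Omega -> \bar R :=
    fun w => counting (common_zeros (fun i k => Z i k w)) in
  measurable_fun [set: Omega] nb_zeros /\
  (\int[P]_w nb_zeros w =
    (p%:R ^ (d%:Z * Num.floor (logb p%:R N%:R : R)) *
     (\sum_(j < d.+1) p%:R ^- j)^-1)%:E)%E.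
Proof.
have p1 := prime_gt1 p_pr.
have /andP[pn_le N_lt] := trunc_log_bounds p1 N_gt0.
split; first exact: (nb_zeros_measurable N_lt).
rewrite (expected_nb_zeros N_lt pn_le Z_indep Z_gauss) floor_logb //.
by rewrite -PoszM -exprnP mulnC exprM -!natrX.
Qed.
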